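(* Let $F_k$ be the free group with a fixed basis $X=\{x_1,\ldots,x_k\}$, let $H\le J\le F_k$ be finitely generated subgroups, and let $t$ be the minimal number of complementary generators needed to obtain $J$ from $H$, i.e. the smallest cardinality of a set $S\subseteq F_k$ with $J=\langle H,S\rangle$. Let $\eta:\Gamma_X(H)\to\Gamma_X(J)$ be the unique core-graph morphism, and let $M$ be the subgroup $H\le M\le J$ whose core graph is the image $\eta(\Gamma_X(H))$. Then $$t=\rho_X(H,M)+\mathrm{rk}(J)-\mathrm{rk}(M).$$
   Context: Core graphs: for $H\le F_k$, the Schreier coset graph has as vertices the right cosets $Hw$, basepoint $H$, and for every coset $Hw$ and every $i$ a directed edge labeled $i$ from $Hw$ to $Hwx_i$. The core graph $\Gamma_X(H)$ is the pointed, directed, edge-labeled subgraph consisting of the basepoint and all vertices and edges traversed by some reduced (non-backtracking) path that starts and ends at the basepoint. It is finite iff $H$ is finitely generated, and $H\mapsto\Gamma_X(H)$ is a bijection between subgroups of $F_k$ and (isomorphism classes of) core graphs. A morphism of core graphs maps vertices to vertices and edges to edges, preserving incidence, basepoint, and directions and labels of edges. A morphism $\Gamma_X(H)\to\Gamma_X(J)$ exists iff $H\le J$, and it is then unique. Its image is a core graph. $\Gamma_X(J)$ is a quotient of $\Gamma_X(H)$ if this morphism exists and is surjective on vertices and on edges. Immediate quotients: let $\Gamma$ be a finite core graph and $u\ne v$ two vertices of $\Gamma$. Identify $u$ with $v$, and then, as long as there are two distinct edges with the same label sharing the same origin (resp. terminus), merge these two edges and their termini (resp. origins). The resulting core graph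 is called an immediate quotient of $\Gamma$. Distance: if $\Gamma_X(M)$ is a quotient of $\Gamma_X(H)$ ($H,M$ finitely generated), $\rho_X(H,M)$ is the smallest $m\ge 0$ for which there are core graphs $\Gamma_0=\Gamma_X(H),\Gamma_1,\ldots,\Gamma_m=\Gamma_X(M)$ with $\Gamma_{i}$ an immediate quotient of $\Gamma_{i-1}$ for each $1\le i\le m$. *)

(* Defs.v *)
From HB Require Import structures.
From mathcomp Require Import all_boot all_order all_algebra.
From mathcomp Require Import finmap.
From mathcomp Require Import boolp classical_sets.
From Stdlib Require Import Relation_Operators.

Set Implicit Arguments.
Unset Strict Implicit.
Unset Printing Implicit Defensive.

Local Open Scope classical_set_scope.

(* In a letter (a, b) over T, the boolean b is the exponent: (a, true) stands
   for a and (a, false) for its formal inverse. The same encoding is used for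
   the steps of a path in a graph, (e, false) being the edge e traversed
   backwards. *)
Definition opposite (T : Type) (s : T * bool) : T * bool := (s.1, ~~ s.2).

Definition reduced (T : eqType) (w : seq (T * bool)) : bool :=
  sorted (fun s1 s2 => s2 != opposite s1) w.

Definition free_group (k : nat) : Type :=
  {w : seq ('I_k * bool) | reduced w}.

HB.instance Definition _ k :=
  Choice.copy (free_group k) {w : seq ('I_k * bool) | reduced w}.

Section FreeGroup.
Variable k : nat.
Implicit Types (a : 'I_k * bool) (u v w : seq ('I_k * bool)).

Definition push a w : seq ('I_k * bool) :=
  if w is b :: w' then if b == opposite a then w' else a :: w else [:: a].

Lemma oppositeK : involutive (@opposite 'I_k).
Proof. by case=> i b; rewrite /opposite /= negbK. Qed.

Lemma reduced_cons a w : reduced (a :: w) -> reduced w.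
Proof. exact: path_sorted. Qed.

Lemma push_reduced a w : reduced w -> reduced (push a w).
Proof.
case: w => [//|b w] rw /=; case: eqP => [_|/eqP nab]; first exact: reduced_cons rw.
by rewrite /reduced /= nab.
Qed.

Lemma push_cons a w : reduced (a :: w) -> push a w = a :: w.
Proof. by case: w => [//|b w] /= /andP[/negPf->]. Qed.

Lemma pushK a w : reduced w -> push a (push (opposite a) w) = w.
Proof.
case: w => [_|b w rw] /=; first by rewrite eqxx.
rewrite oppositeK; case: eqP => [eba|_]; last by rewrite /= eqxx.
by rewrite -eba push_cons.
Qed.

Lemma foldr_push_reduced u w : reduced w -> reduced (foldr push w u).
Proof. by move=> rw; elim: u => [//|a u IHu] /=; apply: push_reduced. Qed.

Lemma foldr_push_push a u w :
  reduced w -> foldr push w (push a u) = push a (foldr push w u).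
Proof.
move=> rw; case: u => [//|b u] /=; case: eqP => [->|//].
by rewrite pushK // foldr_push_reduced.
Qed.

Lemma foldr_push_foldr u v w :
  reduced w -> foldr push w (foldr push v u) = foldr push (foldr push w v) u.
Proof.
by move=> rw; elim: u => [//|a u IHu] /=; rewrite foldr_push_push // IHu.
Qed.

Lemma foldr_push_nil u : reduced u -> foldr push [::] u = u.
Proof.
elim: u => [//|a u IHu] rau /=.
by rewrite IHu ?push_cons //; apply: reduced_cons rau.
Qed.

Definition inverse_word u := rev (map (@opposite 'I_k) u).

Lemma inverse_wordK : involutive inverse_word.
Proof.
by move=> u; rewrite /inverse_word map_rev revK -map_comp map_id_in // => x _; exact: oppositeK.
Qed.

Lemma inverse_word_reduced u : reduced u -> reduced (inverse_word u).
Proof.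
rewrite /reduced /inverse_word rev_sorted sorted_map.
apply: sub_sorted => a b /=; apply: contraNneq => ->.
by rewrite oppositeK.
Qed.

Lemma foldr_push_inv u w :
  reduced w -> foldr push (foldr push w u) (inverse_word u) = w.
Proof.
elim: u w => [//|a u IHu] w rw; rewrite /inverse_word /= rev_cons foldr_rcons.
have := pushK (opposite a) (foldr_push_reduced u rw).
by rewrite oppositeK => ->; exact: IHu.
Qed.

Definition free_one : free_group k := exist _ [::] isT.
Definition free_mul (x y : free_group k) : free_group k :=
  exist _ (foldr push (val y) (val x)) (foldr_push_reduced (val x) (valP y)).
Definition free_inv (x : free_group k) : free_group k :=
  exist _ (inverse_word (val x)) (inverse_word_reduced (valP x)).

Lemma free_mulA : associative free_mul.
Proof.
by move=> x y z; apply: val_inj; rewrite /= foldr_push_foldr //; apply: valP.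
Qed.

Lemma free_mul1 : left_id free_one free_mul.
Proof. by move=> x; apply: val_inj. Qed.

Lemma free_mulr1 : right_id free_one free_mul.
Proof. by move=> x; apply: val_inj; rewrite /= foldr_push_nil //; apply: valP. Qed.

Lemma free_mulV : left_inverse free_one free_inv free_mul.
Proof.
move=> x; apply: val_inj => /=.
by rewrite -[X in foldr _ X _](foldr_push_nil (valP x)) foldr_push_inv.
Qed.

Lemma free_mulrV : right_inverse free_one free_inv free_mul.
Proof.
move=> x; rewrite -{1}[x](_ : free_inv (free_inv x) = x) ?free_mulV //.
by apply: val_inj; rewrite /= inverse_wordK.
Qed.

HB.instance Definition _ := isGroup.Build (free_group k)
  free_mulA free_mul1 free_mulr1 free_mulV free_mulrV.

Definition basis_elt (i : 'I_k) : free_group k := exist _ [:: (i, true)] isT.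

End FreeGroup.

Local Open Scope group_scope.

Section Subgroups.
Variable G : groupType.
Implicit Types H J S : set G.

Definition subgroup H : Prop := group_closed (mem H).

Definition generated S : set G := smallest subgroup S.

Definition finitely_generated H : Prop :=
  exists S : {fset G}, H = generated [set` S].

End Subgroups.

(* Both functions below return the default value 0 when no suitable number
   exists. *)
Definition least (P : set nat) : nat :=
  xget 0 [set n | P n /\ forall m, P m -> n <= m].

Definition rank (k : nat) (J : set (free_group k)) : nat :=
  xget 0 [set n | exists phi : {multiplicative free_group n -> free_group k},
                    injective phi /\ range phi = J].

Definition complementary_rank (k : nat) (H J : set (free_group k)) : nat :=
  least [set n | exists S : {fset free_group k},
                   #|` S| = n /\ J = generated (H `|` [set` S])].

Record graph (k : nat) := Graph {
  vertex : eqType;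
  edge : eqType;
  origin : edge -> vertex;
  terminus : edge -> vertex;
  label : edge -> 'I_k;
  basepoint : vertex }.

Section Graphs.
Variable k : nat.
Implicit Types G : graph k.

Record graph_morphism G G' := GraphMorphism {
  vmap : vertex G -> vertex G';
  emap : edge G -> edge G';
  morph_origin : forall e, origin (emap e) = vmap (origin e);
  morph_terminus : forall e, terminus (emap e) = vmap (terminus e);
  morph_label : forall e, label (emap e) = label e;
  morph_basepoint : vmap (basepoint G) = basepoint G' }.

Definition isomorphic G G' : Prop :=
  exists f : graph_morphism G G', bijective (vmap f) /\ bijective (emap f).

Definition subgraph G (VS : set (vertex G)) (ES : set (edge G))
    (VS_base : basepoint G \in VS)
    (VS_origin : forall e : ES, origin (val e) \in VS)
    (VS_terminus : forall e : ES, terminus (val e) \in VS) : graph k :=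
  @Graph k VS ES
    (fun e => SigSub (VS_origin e))
    (fun e => SigSub (VS_terminus e))
    (fun e => label (val e))
    (SigSub VS_base).

Section Image.
Variables (G G' : graph k) (f : graph_morphism G G').

Lemma image_basepoint : basepoint G' \in range (vmap f).
Proof. by rewrite -(morph_basepoint f); apply/mem_set; exists (basepoint G). Qed.

Lemma image_origin (e : range (emap f)) : origin (val e) \in range (vmap f).
Proof.
case: e => e /= /set_mem[d _ <-]; rewrite morph_origin.
by apply/mem_set; exists (origin d).
Qed.

Lemma image_terminus (e : range (emap f)) : terminus (val e) \in range (vmap f).
Proof.
case: e => e /= /set_mem[d _ <-]; rewrite morph_terminus.
by apply/mem_set; exists (terminus d).
Qed.

Definition image_graph : graph k :=
  subgraph image_basepoint image_origin image_terminus.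

End Image.

Definition step_source G (s : edge G * bool) : vertex G :=
  if s.2 then origin s.1 else terminus s.1.

Definition step_target G (s : edge G * bool) : vertex G :=
  if s.2 then terminus s.1 else origin s.1.

Fixpoint walk G (v : vertex G) (p : seq (edge G * bool)) (w : vertex G) : bool :=
  if p is s :: p' then (step_source s == v) && walk (step_target s) p' w
  else v == w.

Section Core.
Variable G : graph k.

Definition reduced_loop (p : seq (edge G * bool)) : bool :=
  reduced p && walk (basepoint G) p (basepoint G).

Definition traversed_vertices : set (vertex G) :=
  [set v | exists2 p, reduced_loop p &
                      v \in basepoint G :: map (@step_target G) p].

Definition traversed_edges : set (edge G) :=
  [set e | exists2 p, reduced_loop p & e \in map fst p].

Lemma walk_step v p w (s : edge G * bool) : walk v p w -> s \in p ->
  step_source s \in v :: map (@step_target G) p /\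
  step_target s \in v :: map (@step_target G) p.
Proof.
elim: p v => [//|t p IHp] v /= /andP[/eqP tv wp].
rewrite inE => /predU1P[->|/(IHp _ wp)[sp tp]].
  by rewrite -tv /= !inE !eqxx ?orbT.
by rewrite sp orbT; split=> //; rewrite in_cons tp orbT.
Qed.

Lemma traversed_ends e : traversed_edges e ->
  traversed_vertices (origin e) /\ traversed_vertices (terminus e).
Proof.
case=> p lp /mapP[[d b] sp /= ->]; have /andP[_ wp] := lp.
have [ss st] := walk_step wp sp.
by case: b ss st {sp} => ss st; split; exists p.
Qed.

Lemma traversed_basepoint : basepoint G \in traversed_vertices.
Proof. by apply/mem_set; exists [::]; rewrite ?inE ?/reduced_loop /= eqxx. Qed.

Lemma traversed_origin (e : traversed_edges) :
  origin (val e) \in traversed_vertices.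
Proof. by apply/mem_set; case: (traversed_ends (set_valP e)). Qed.

Lemma traversed_terminus (e : traversed_edges) :
  terminus (val e) \in traversed_vertices.
Proof. by apply/mem_set; case: (traversed_ends (set_valP e)). Qed.

Definition core : graph k :=
  subgraph traversed_basepoint traversed_origin traversed_terminus.

End Core.

Section Folding.
Variables (G : graph k) (u v : vertex G).

Definition merge (T : Type) (R : T -> T -> Prop) (x y : T) : T -> T -> Prop :=
  clos_refl_sym_trans T (fun a b => R a b \/ (a = x /\ b = y)).

(* The successive graphs of the folding process are quotients of G; each of
   them is recorded by the equivalence relations it induces on the vertices
   and on the edges of G. *)
Inductive folding : (vertex G -> vertex G -> Prop) ->
                    (edge G -> edge G -> Prop) -> Prop :=
| folding_start : folding (merge eq u v) eq
| folding_origin RV RE (d e : edge G) :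
    folding RV RE -> ~ RE d e -> label d = label e ->
    RV (origin d) (origin e) ->
    folding (merge RV (terminus d) (terminus e)) (merge RE d e)
| folding_terminus RV RE (d e : edge G) :
    folding RV RE -> ~ RE d e -> label d = label e ->
    RV (terminus d) (terminus e) ->
    folding (merge RV (origin d) (origin e)) (merge RE d e).

Definition folded (RV : vertex G -> vertex G -> Prop)
    (RE : edge G -> edge G -> Prop) : Prop :=
  forall d e, label d = label e ->
    RV (origin d) (origin e) \/ RV (terminus d) (terminus e) -> RE d e.

End Folding.

(* G' is isomorphic to the quotient of G by RV and RE. *)
Definition is_quotient_by G G' (RV : vertex G -> vertex G -> Prop)
    (RE : edge G -> edge G -> Prop) : Prop :=
  exists f : graph_morphism G G',
    [/\ range (vmap f) = setT, range (emap f) = setT,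
        forall x y, vmap f x = vmap f y <-> RV x y
      & forall d e, emap f d = emap f e <-> RE d e].

Definition immediate_quotient G G' : Prop :=
  exists (u v : vertex G) (RV : vertex G -> vertex G -> Prop)
         (RE : edge G -> edge G -> Prop),
    [/\ u <> v, folding u v RV RE, folded RV RE & is_quotient_by G' RV RE].

End Graphs.

Section CoreGraphs.
Variable k : nat.
Implicit Types H M : set (free_group k).

Definition translate H (w : free_group k) : set (free_group k) :=
  (fun h => h * w) @` H.

Definition right_cosets H : set (set (free_group k)) := range (translate H).

Lemma translate_coset H (A : right_cosets H) (w : free_group k) :
  translate (val A) w \in right_cosets H.
Proof.
case: A => A /= /set_mem[v _ <-]; apply/mem_set; exists (v * w) => //.
by rewrite /translate image_comp; apply: eq_imagel => h _; rewrite /= mulgA.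
Qed.

Lemma subgroup_coset H : H \in right_cosets H.
Proof.
apply/mem_set; exists 1 => //; rewrite /translate -[RHS]image_id.
by apply: eq_imagel => h _; rewrite mulg1.
Qed.

(* The edge (A, i) goes from the coset A to the coset A x_i. *)
Definition schreier_graph H : graph k :=
  @Graph k (right_cosets H) (right_cosets H * 'I_k)%type
    fst (fun e => SigSub (translate_coset e.1 (basis_elt e.2))) snd
    (SigSub (subgroup_coset H)).

Definition core_graph H : graph k := core (schreier_graph H).

(* Core graphs are the graphs core_graph L with L a subgroup, so a chain of
   core graphs is given by a sequence of subgroups. *)
Definition distance H M : nat :=
  least [set m | exists L : nat -> set (free_group k),
    [/\ forall i, i <= m -> subgroup (L i), L 0 = H, L m = M
      & forall i, i < m ->
          immediate_quotient (core_graph (L i)) (core_graph (L i.+1))]].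

End CoreGraphs.

(* Main.v *)
(* Fold the graph obtained from the core graph of H by attaching one petal per
complementary generator, folding inside the image of the core of H first. Write
E and V for the numbers of edges and vertices. A fold never increases the
difference between E - V for the whole graph and E - V for the image of the
core, and every fold that identifies two vertices of that image decreases it,
while such an identification is an immediate quotient. The difference starts at
t and is rk J - rk M when the folding ends, since the rank of a subgroup is
E - V + 1 for its core graph; hence rho(H, M) <= t - (rk J - rk M). Conversely,
an immediate quotient adjoins one generator, and M is a free factor of J because
its core graph is a subgraph of that of J, so a spanning tree of the core graph
of M extends to one of that of J and J is obtained from M by adjoining
rk J - rk M elements. *)
Require Import Defs.
From HB Require Import structures.
From mathcomp Require Import all_boot all_order all_algebra.
From mathcomp Require Import finmap.
From mathcomp Require Import boolp classical_sets.
From mathcomp Require Import zify.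
From Stdlib Require Import Relation_Operators.

Set Implicit Arguments.
Unset Strict Implicit.
Unset Printing Implicit Defensive.

(** * Words and subgroups *)

(** The folding is cut into rounds. A round starts from a petal graph over the core of L and stops
    as soon as a fold merges two vertices x, y of that core. What remains outside the core is then
    converted back into complementary generators over N = <L, x y^-1> by collapsing a spanning
    forest, and the next round starts from a fresh petal graph over N. A round therefore only has to
    show that strictly fewer generators suffice afterwards; the further folds inside the core belong
    to the immediate quotient and are never counted. The induction runs on the number of generators,
    and at its end, where the core of L embeds in that of J and L = M, only a comparison of ranks is
    left. Cosets are represented by group elements modulo an equivalence, and cores, Schreier graphs
    and partly folded graphs are all read as automata. The recurring tool is that whatever a
    deterministic automaton reads, it still reads after free reduction: it gives the finiteness of
    cores, the injectivity of the map from a free group to a fundamental group, and the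
    identification of a completely folded graph with a core. *)

Section Words.
Local Open Scope group_scope.
Variable k : nat.
Implicit Types (a : 'I_k * bool) (u v w : seq ('I_k * bool)) (x y z : free_group k).

Definition letter a : free_group k := exist _ [:: a] isT.

Definition eval w : free_group k := foldr (fun a x => letter a * x) 1 w.

Lemma eval_cat u v : eval (u ++ v) = eval u * eval v.
Proof. by elim: u => [|a u IHu] /=; rewrite ?mul1g // IHu mulgA. Qed.

Lemma val_eval w : val (eval w) = foldr (@push k) [::] w.
Proof. by elim: w => [//|a w IHw] /=; rewrite IHw. Qed.

Lemma val_eval_reduced w : reduced w -> val (eval w) = w.
Proof. by move=> rw; rewrite val_eval foldr_push_nil. Qed.

Lemma eval_val x : eval (val x) = x.
Proof. by apply: val_inj; rewrite val_eval_reduced //; apply: valP. Qed.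

Lemma letter_opposite a : letter (opposite a) = (letter a)^-1.
Proof. exact: val_inj. Qed.

Lemma oppositeM a : letter a * letter (opposite a) = 1.
Proof. by rewrite letter_opposite mulgV. Qed.

Lemma eval_inverse w : eval (inverse_word w) = (eval w)^-1.
Proof.
elim: w => [|a w IHw] /=; first by rewrite invg1.
by rewrite /inverse_word /= rev_cons -cats1 eval_cat IHw /= mulg1 letter_opposite invgM.
Qed.

Lemma inverse_word_cat u v :
  inverse_word (u ++ v) = inverse_word v ++ inverse_word u.
Proof. by rewrite /inverse_word map_cat rev_cat. Qed.

Lemma inverse_word_cons a w :
  inverse_word (a :: w) = inverse_word w ++ [:: opposite a].
Proof. by rewrite -cat1s inverse_word_cat. Qed.

Lemma letter_basis i : letter (i, true) = basis_elt i.
Proof. exact: val_inj. Qed.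

End Words.

(** * Universal property of the free group *)

Section Lift.
Local Open Scope group_scope.
Variables (n : nat) (G : groupType) (g : 'I_n -> G).

Definition lift_letter (a : 'I_n * bool) : G := if a.2 then g a.1 else (g a.1)^-1.

Definition lift_word (w : seq ('I_n * bool)) : G :=
  foldr (fun a x => lift_letter a * x) 1 w.

Lemma lift_letter_opposite a : lift_letter (opposite a) = (lift_letter a)^-1.
Proof. by case: a => i [] /=; rewrite /lift_letter //= invgK. Qed.

Lemma lift_word_push a w : lift_word (push a w) = lift_letter a * lift_word w.
Proof.
case: w => [//|b w] /=; case: eqP => [->|//].
by rewrite lift_letter_opposite mulVKg.
Qed.

Definition free_lift (x : free_group n) : G := lift_word (val x).

Lemma free_liftM : {morph free_lift : x y / x * y}.
Proof.
move=> x y; rewrite /free_lift /=; elim: (val x) => [|a u IHu] /=.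
  by rewrite mul1g.
by rewrite lift_word_push IHu mulgA.
Qed.

HB.instance Definition _ := isMultiplicative.Build _ _ free_lift free_liftM.

Lemma free_lift_basis i : free_lift (basis_elt i) = g i.
Proof. by rewrite /free_lift /= mulg1. Qed.

End Lift.

(** * Generated subgroups and right cosets *)

Section Subgroups.
Local Open Scope group_scope.
Local Open Scope classical_set_scope.
Variable G : groupType.
Implicit Types (H J S : set G) (x y : G).

Lemma subgroupP H :
  subgroup H <-> [/\ H 1, forall x y, H x -> H y -> H (x * y) &
                    forall x, H x -> H x^-1].
Proof.
split=> [sH|[H1 HM HV]].
  split; first by case: sH => /set_mem.
    by move=> x y Hx Hy; apply: set_mem; apply: (group_closedM sH); apply: mem_set.
  by move=> x Hx; apply: set_mem; apply: (group_closedV sH); apply: mem_set.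
split; first exact: mem_set.
by move=> x y /set_mem Hx /set_mem Hy; apply: mem_set; apply/HM/HV.
Qed.

Lemma subgroup1 H : subgroup H -> H 1.
Proof. by case/subgroupP. Qed.

Lemma subgroupM H x y : subgroup H -> H x -> H y -> H (x * y).
Proof. by case/subgroupP=> _ HM _; apply: HM. Qed.

Lemma subgroupV H x : subgroup H -> H x -> H x^-1.
Proof. by case/subgroupP=> _ _; apply. Qed.

Lemma subgroup_generated S : subgroup (generated S).
Proof.
apply/subgroupP; split=> [A [sA _]|x y Hx Hy A|x Hx A].
- exact: subgroup1.
- by move=> sA; apply: subgroupM; [case: sA|apply: Hx|apply: Hy].
- by move=> sA; apply: subgroupV; [case: sA|apply: Hx].
Qed.

Lemma generated_sub S H : subgroup H -> S `<=` H -> generated S `<=` H.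
Proof. exact: smallest_sub. Qed.

Lemma sub_generated S : S `<=` generated S.
Proof. exact: sub_gen_smallest. Qed.

Lemma generated_mono S T : S `<=` T -> generated S `<=` generated T.
Proof.
move=> sST; apply: generated_sub; first exact: subgroup_generated.
exact: subset_trans (@sub_generated T).
Qed.

Lemma generatedUl S T : generated (generated S `|` T) = generated (S `|` T).
Proof.
apply/seteqP; split; apply: generated_sub; try exact: subgroup_generated.
  move=> x [|Tx]; first by apply: generated_mono => y; left.
  by apply: sub_generated; right.
by move=> x [Sx|Tx]; apply: sub_generated; [left; apply: sub_generated|right].
Qed.

Lemma generated_id H : subgroup H -> generated H = H.
Proof. by move=> sH; apply: smallest_id. Qed.

(** Equality of the right cosets H x and H y, kept as a relation on representatives so that vertices
    of coset graphs can be plain group elements. *)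
Definition same_coset H x y : Prop := H (x * y^-1).

Variable H : set G.
Hypothesis sH : subgroup H.

Lemma same_coset_refl x : same_coset H x x.
Proof. by rewrite /same_coset mulgV; apply: subgroup1. Qed.

Lemma same_coset_sym x y : same_coset H x y -> same_coset H y x.
Proof. by rewrite /same_coset => /(subgroupV sH); rewrite invgM invgK. Qed.

Lemma same_coset_trans y x z :
  same_coset H x y -> same_coset H y z -> same_coset H x z.
Proof.
rewrite /same_coset => Hxy Hyz.
by have := subgroupM sH Hxy Hyz; rewrite mulgA mulgVK.
Qed.

Lemma same_cosetM x y z : same_coset H (x * z) (y * z) <-> same_coset H x y.
Proof. by rewrite /same_coset invgM mulgA mulgK. Qed.

Lemma same_coset1 x : same_coset H x 1 <-> H x.
Proof. by rewrite /same_coset invg1 mulg1. Qed.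

Lemma same_coset1l x : same_coset H 1 x <-> H x.
Proof. by split=> [/same_coset_sym/same_coset1|/same_coset1/same_coset_sym]. Qed.

(** The basepoint is often represented by some x in H other than 1; this extracts the label y of a
    loop read there. *)
Lemma same_coset_absorb x y : H x -> same_coset H (x * y) x -> H y.
Proof.
move=> Hx Hxy; have := subgroupM sH (subgroupV sH Hx) (subgroupM sH Hxy Hx).
by rewrite mulgVK mulKg.
Qed.

Lemma same_coset_mem x y : H x -> H y -> same_coset H x y.
Proof. by move=> Hx Hy; apply: subgroupM => //; apply: subgroupV. Qed.

End Subgroups.

(** * Reading words in an automaton *)

Section Automata.
Local Open Scope group_scope.
Local Open Scope classical_set_scope.
Variable k : nat.
Implicit Types (a : 'I_k * bool) (u v w : seq ('I_k * bool)).

(* The states are the classes of X modulo R; the automaton is kept as a setoid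
   so that a graph can be folded without changing its vertex type. *)
Record automaton (X : Type) (R : X -> X -> Prop)
    (T : X -> 'I_k * bool -> X -> Prop) : Prop := Automaton {
  state_refl : forall x, R x x;
  state_sym : forall x y, R x y -> R y x;
  state_trans : forall y x z, R x y -> R y z -> R x z;
  step_compat : forall x x' a y y', R x x' -> R y y' -> T x a y -> T x' a y';
  step_opposite : forall x a y, T x a y -> T y (opposite a) x }.

Definition deterministic (X : Type) (R : X -> X -> Prop)
    (T : X -> 'I_k * bool -> X -> Prop) : Prop :=
  forall x a y z, T x a y -> T x a z -> R y z.

Fixpoint read (X : Type) (R : X -> X -> Prop)
    (T : X -> 'I_k * bool -> X -> Prop) x w y : Prop :=
  if w is a :: w' then exists2 z, T x a z & read R T z w' y else R x y.

Section Read.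
Variables (X : Type) (R : X -> X -> Prop) (T : X -> 'I_k * bool -> X -> Prop).
Hypothesis RT : automaton R T.
Notation read := (read R T).
Implicit Types x y z : X.

Lemma read_compat x x' w y y' : R x x' -> R y y' -> read x w y -> read x' w y'.
Proof.
case: RT => Rr Rs Rt Tc _; elim: w x x' => [|a w IHw] x x' /= xx' yy'.
  by move=> xy; apply: Rt (Rs _ _ xx') (Rt _ _ _ xy yy').
case=> z Txz zy; exists z; first exact: Tc Txz.
exact: IHw zy.
Qed.

Lemma read_cat x u v y :
  read x (u ++ v) y <-> exists2 z, read x u z & read z v y.
Proof.
elim: u x => [|a u IHu] x /=.
  split=> [xy|[z xz zy]]; first by exists x => //; apply: state_refl RT x.
  by apply: read_compat zy; [apply: state_sym RT _ _ xz|apply: state_refl RT y].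
split=> [[z Txz /IHu[t zt ty]]|[t [z Txz zt] ty]].
  by exists t => //; exists z.
by exists z => //; apply/IHu; exists t.
Qed.

Lemma read1 x a y : read x [:: a] y <-> T x a y.
Proof.
split=> [[z Txz zy]|Txy]; last by exists y => //; apply: state_refl RT y.
exact: (step_compat RT (state_refl RT x) zy Txz).
Qed.

Lemma read_inverse x w y : read x w y -> read y (inverse_word w) x.
Proof.
elim: w x => [|a w IHw] x /=; first exact: state_sym RT x y.
case=> z Txz /IHw yz; rewrite inverse_word_cons; apply/read_cat.
by exists z => //; apply/read1/(step_opposite RT).
Qed.

Hypothesis Tdet : deterministic R T.

Lemma read_det x w y z : read x w y -> read x w z -> R y z.
Proof.
elim: w x => [|a w IHw] x /=.
  by move=> xy xz; apply: state_trans RT _ _ _ (state_sym RT xy) xz.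
case=> t Txt ty [s Txs sz]; apply: IHw ty _.
by apply: read_compat sz; [apply: Tdet Txs Txt|apply: state_refl RT z].
Qed.

(** Determinism makes [a] followed by its opposite return to the starting state, so the pair can be
    cancelled. *)
Lemma read_push x a w y : read x (a :: w) y -> read x (push a w) y.
Proof.
case: w => [//|b w] /=; case: eqP => [->|//] [z Txz [t Tzt ty]].
apply: read_compat ty; last exact: state_refl RT y.
exact: Tdet Tzt (step_opposite RT Txz).
Qed.

Lemma read_eval x w y : read x w y -> read x (val (eval w)) y.
Proof.
rewrite val_eval; elim: w x => [//|a w IHw] x /= [z Txz zy].
by apply: read_push; exists z => //; apply: IHw.
Qed.

Lemma read_mul x (g h : free_group k) y z :
  read x (val g) y -> read y (val h) z -> read x (val (g * h)) z.
Proof.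
move=> xy yz; have /read_eval : read x (val g ++ val h) z.
  by apply/read_cat; exists y.
by rewrite eval_cat !eval_val.
Qed.

Lemma read_inv x (g : free_group k) y : read x (val g) y -> read y (val g^-1) x.
Proof. exact: read_inverse. Qed.

(** Lets statements about all loops of a generated subgroup be checked on generators only. *)
Lemma subgroup_read x : subgroup [set g : free_group k | read x (val g) x].
Proof.
apply/subgroupP; split=> [|g h|g] /=; first exact: state_refl RT x.
  exact: read_mul.
exact: read_inv.
Qed.

Lemma read_eval_eq x u v y z : read x u y -> read x v z -> eval u = eval v -> R y z.
Proof. by move=> /read_eval xy /read_eval xz uv; apply: read_det xy _; rewrite uv. Qed.

End Read.

Lemma read_mono X (R R' : X -> X -> Prop) (T T' : X -> 'I_k * bool -> X -> Prop) x w y :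
  (forall x y, R x y -> R' x y) -> (forall x a y, T x a y -> T' x a y) ->
  read R T x w y -> read R' T' x w y.
Proof.
move=> RR' TT'; elim: w x => [|a w IHw] x /=; first exact: RR'.
by case=> z Txz zy; exists z; [apply: TT'|apply: IHw].
Qed.

Lemma read_same_coset X (R : X -> X -> Prop) (T : X -> 'I_k * bool -> X -> Prop)
    (L : set (free_group k)) (f : X -> free_group k) x w y :
  subgroup L -> (forall x y, R x y -> same_coset L (f x) (f y)) ->
  (forall x a y, T x a y -> same_coset L (f x * letter a) (f y)) ->
  read R T x w y -> same_coset L (f x * eval w) (f y).
Proof.
move=> sL RL TL; elim: w x => [|a w IHw] x /=; first by rewrite mulg1 => /RL.
case=> z /TL xz /IHw; apply: same_coset_trans => //.
by rewrite mulgA same_cosetM.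
Qed.

End Automata.

(** * Cores of subgroups in terms of words *)

Section CoreWords.
Local Open Scope group_scope.
Local Open Scope classical_set_scope.
Variable k : nat.
Implicit Types (a : 'I_k * bool) (u v w q r : seq ('I_k * bool)).
Implicit Types (L N : set (free_group k)) (x y z : free_group k).

(* The edge of the Schreier graph leaving the coset L x along the letter a
   lies on a reduced loop at L. *)
Definition core_edge L x a : Prop :=
  exists q r, [/\ reduced (q ++ a :: r), L (eval (q ++ a :: r)) &
                  same_coset L x (eval q)].

(** The basepoint is listed separately because it has no incident core edge when L is trivial. *)
Definition core_vertex L x : Prop := same_coset L x 1 \/ exists a, core_edge L x a.

Definition core_step L x a y : Prop :=
  core_edge L x a /\ same_coset L (x * letter a) y.

Definition core_read L := read (same_coset L) (core_step L).

Section Fixed.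
Variable L : set (free_group k).
Hypothesis sL : subgroup L.

Lemma core_edge_compat x y a : same_coset L x y -> core_edge L x a -> core_edge L y a.
Proof.
move=> xy [q [r [red Lw xq]]]; exists q, r; split=> //.
exact: same_coset_trans (same_coset_sym sL xy) xq.
Qed.

Lemma core_vertex_compat x y : same_coset L x y -> core_vertex L x -> core_vertex L y.
Proof.
move=> xy [x1|[a xa]]; last by right; exists a; apply: core_edge_compat xa.
by left; apply: same_coset_trans (same_coset_sym sL xy) x1.
Qed.

Lemma core_edge_opposite x a :
  core_edge L x a -> core_edge L (x * letter a) (opposite a).
Proof.
move=> [q [r [red Lw xq]]]; exists (inverse_word r), (inverse_word q).
have eqw : inverse_word r ++ opposite a :: inverse_word q = inverse_word (q ++ a :: r).
  by rewrite inverse_word_cat inverse_word_cons -catA.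
split; first by rewrite eqw inverse_word_reduced.
  by rewrite eqw eval_inverse; apply: subgroupV.
have xqa : same_coset L (x * letter a) (eval q * letter a) by apply/same_cosetM.
apply: same_coset_trans xqa _ => //.
by rewrite /same_coset eval_inverse invgK; move: Lw; rewrite eval_cat /= mulgA.
Qed.

Lemma core_vertex_end x a : core_edge L x a -> core_vertex L (x * letter a).
Proof. by move=> xa; right; exists (opposite a); apply: core_edge_opposite. Qed.

Lemma core_automaton : automaton (same_coset L) (core_step L).
Proof.
split; [exact: same_coset_refl|exact: same_coset_sym|exact: same_coset_trans| |].
  move=> x x' a y y' xx' yy' [xa xay]; split; first exact: core_edge_compat xa.
  apply: same_coset_trans yy' => //; apply: same_coset_trans xay => //.
  by apply/same_cosetM; apply: (same_coset_sym sL).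
move=> x a y [xa xay]; split.
  by apply: core_edge_compat xay _; apply: core_edge_opposite.
rewrite -(same_cosetM L _ _ (letter (opposite a))) -!mulgA oppositeM mulg1 in xay.
exact: same_coset_sym.
Qed.

Lemma core_deterministic : deterministic (same_coset L) (core_step L).
Proof.
by move=> x a y z [_ xy] [_ xz]; apply: same_coset_trans xz => //; apply: (same_coset_sym sL).
Qed.

(** The prefix q already read is carried along because [core_edge] refers to the whole reduced loop
    through the edge. *)
Lemma core_read_loop q r : reduced (q ++ r) -> L (eval (q ++ r)) ->
  core_read L (eval q) r 1.
Proof.
elim: r q => [|a r IHr] q red Lw /=; first by apply/same_coset1; rewrite cats0 in Lw.
exists (eval q * letter a).
  split; last exact: same_coset_refl.
  by exists q, r; split=> //; apply: same_coset_refl.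
have -> : eval q * letter a = eval (rcons q a) by rewrite -cats1 eval_cat /= mulg1.
by apply: IHr; rewrite cat_rcons.
Qed.

Lemma core_read_val x : L x -> core_read L 1 (val x) 1.
Proof.
move=> Lx; rewrite -[X in core_read L X](_ : eval [::] = 1) //.
by apply: core_read_loop; [exact: valP|rewrite /= eval_val].
Qed.

Lemma core_read_coset x w y : core_read L x w y -> same_coset L (x * eval w) y.
Proof. by apply: (read_same_coset (f := id)) => // {}x a {}y []. Qed.

(** Connectedness of the core: a core vertex is the end of a prefix of a reduced loop. *)
Lemma core_vertex_read x : core_vertex L x -> exists w, core_read L 1 w x.
Proof.
case=> [x1|[a [q [r [red Lw xq]]]]]; first by exists [::]; apply: (same_coset_sym sL).
have := @core_read_loop [::] _ red Lw.
move=> /(read_cat core_automaton)[z qz _]; exists q.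
have /core_read_coset := qz; rewrite mul1g => qz'.
apply: (read_compat core_automaton) qz; first exact: same_coset_refl.
by apply: (same_coset_sym sL) => //; apply: same_coset_trans qz'.
Qed.

End Fixed.

Lemma core_edge_sub L N x a : L `<=` N -> core_edge L x a -> core_edge N x a.
Proof. by move=> LN [q [r [red Lw xq]]]; exists q, r; split=> //; apply: LN. Qed.

Lemma core_vertex_sub L N x : L `<=` N -> core_vertex L x -> core_vertex N x.
Proof.
move=> LN [x1|[a xa]]; first by left; apply: LN.
by right; exists a; apply: core_edge_sub xa.
Qed.

Definition finite_core L : Prop :=
  exists C : seq (free_group k),
    forall x, core_vertex L x -> exists2 c, c \in C & same_coset L x c.

(* The words of L can be read in the subgraph spanned by the prefixes of the
   generators, so this finite subgraph contains the core. *)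
Lemma finitely_generated_core L : finitely_generated L -> finite_core L.
Proof.
move=> [S ->]; set L' := generated _.
have sL : subgroup L' by exact: subgroup_generated.
pose P : seq (free_group k) := 1 :: flatten
  [seq [seq eval (take i (val s)) | i <- iota 0 (size (val s)).+1] | s <- enum_fset S].
pose inP x := exists2 c, c \in P & same_coset L' x c.
have inP_compat x y : same_coset L' x y -> inP x -> inP y.
  move=> xy [c cP xc]; exists c => //.
  exact: same_coset_trans (same_coset_sym sL xy) xc.
pose T x a y := [/\ inP x, inP y & same_coset L' (x * letter a) y].
have aT : automaton (same_coset L') T.
  split; [exact: same_coset_refl|exact: same_coset_sym|exact: same_coset_trans| |].
    move=> x x' a y y' xx' yy' [Px Py xy]; split; [exact: inP_compat Px|exact: inP_compat Py|].
    apply: same_coset_trans yy' => //; apply: same_coset_trans xy => //.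
    by apply/same_cosetM; apply: (same_coset_sym sL).
  move=> x a y [Px Py xy]; split=> //.
  rewrite -(same_cosetM L' _ _ (letter (opposite a))) -!mulgA oppositeM mulg1 in xy.
  by apply: (same_coset_sym sL).
have dT : deterministic (same_coset L') T.
  move=> x a y z [_ _ xy] [_ _ xz].
  exact: same_coset_trans (same_coset_sym sL xy) xz.
have P1 : inP 1 by exists 1; [rewrite inE eqxx|exact: same_coset_refl].
(* The elements read as loops form a subgroup, so only generators are checked, and P contains all
   their prefixes. *)
have readL x : L' x -> read (same_coset L') T 1 (val x) 1.
  apply: (generated_sub (subgroup_read aT dT 1)) => s /= Ss.
  have Pq q r : q ++ r = val s -> inP (eval q).
    move=> qr; exists (eval q); last exact: same_coset_refl.
    rewrite inE; apply/orP; right; apply/flattenP.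
    exists [seq eval (take i (val s)) | i <- iota 0 (size (val s)).+1].
      exact: map_f.
    apply/mapP; exists (size q); last by rewrite -qr take_size_cat.
    by rewrite mem_iota /= add0n ltnS -qr size_cat leq_addr.
  suff: forall r q, q ++ r = val s -> read (same_coset L') T (eval q) r 1.
    by move=> /(_ (val s) [::]); apply.
  elim=> [|a r IHr] q qr /=.
    apply/same_coset1; rewrite -[q]cats0 qr eval_val.
    exact: sub_generated.
  exists (eval q * letter a).
    have qa : eval q * letter a = eval (rcons q a) by rewrite -cats1 eval_cat /= mulg1.
    split; [exact: Pq qr| |exact: same_coset_refl].
    by rewrite qa; apply: (Pq _ r); rewrite cat_rcons.
  have -> : eval q * letter a = eval (rcons q a) by rewrite -cats1 eval_cat /= mulg1.
  by apply: IHr; rewrite cat_rcons.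
exists P => x [x1|[a [q [r [red Lw xq]]]]].
  by exists 1 => //; rewrite inE eqxx.
have := readL _ Lw; rewrite val_eval_reduced // => /(read_cat aT)[z qz [t [Pz _ _] _]].
suff xz : same_coset L' x z by apply: inP_compat Pz; apply: (same_coset_sym sL).
have TL x' b y' : T x' b y' -> same_coset L' (x' * letter b) y' by case.
apply: (same_coset_trans sL) xq _; rewrite -[eval q]mul1g.
exact: (read_same_coset (f := id) sL _ TL qz).
Qed.

End CoreWords.

(** * Rank of a free group *)

Section FreeRank.
Local Open Scope group_scope.
Local Open Scope classical_set_scope.

(** The homomorphism to Z/2 with values f on the basis. Exponents 1 and -1 agree modulo 2, so
    letters are counted without sign. *)
Definition parity n (f : 'I_n -> bool) (x : free_group n) : bool :=
  odd (count (fun a => f a.1) (val x)).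

Lemma odd_count_push n (f : 'I_n -> bool) a w :
  odd (count (fun b => f b.1) (push a w)) = f a.1 (+) odd (count (fun b => f b.1) w).
Proof.
case: w => [|b w] /=; first by rewrite addn0 oddb addbF.
case: eqP => [->|_] /=; last by rewrite oddD oddb.
by rewrite oddD oddb /= addbA addbb.
Qed.

Lemma parityM n (f : 'I_n -> bool) x y : parity f (x * y) = parity f x (+) parity f y.
Proof.
rewrite /parity /=; elim: (val x) => [//|a u IHu] /=.
by rewrite odd_count_push IHu oddD oddb addbA.
Qed.

Lemma parity1 n (f : 'I_n -> bool) : parity f 1 = false.
Proof. by []. Qed.

Lemma parityV n (f : 'I_n -> bool) x : parity f x^-1 = parity f x.
Proof.
have := parityM f x x^-1; rewrite mulgV parity1.
by case: (parity f x) => /=; case: (parity f _).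
Qed.

Lemma group_morph1 (G G' : groupType) (phi : {multiplicative G -> G'}) : phi 1 = 1.
Proof. by apply: (mulgI (phi 1)); rewrite -gmulfM !mulg1. Qed.

Lemma group_morphV (G G' : groupType) (phi : {multiplicative G -> G'}) x :
  phi x^-1 = (phi x)^-1.
Proof. by apply: (mulgI (phi x)); rewrite -gmulfM !mulgV group_morph1. Qed.

Lemma subgroup_range (G G' : groupType) (phi : {multiplicative G -> G'}) :
  subgroup (range phi).
Proof.
apply/subgroupP; split=> [|_ _ [x _ <-] [y _ <-]|_ [x _ <-]].
- by exists 1 => //; rewrite group_morph1.
- by exists (x * y) => //; rewrite gmulfM.
- by exists x^-1 => //; rewrite group_morphV.
Qed.

Lemma free_group_ind n (K : set (free_group n)) :
  subgroup K -> (forall i, K (basis_elt i)) -> forall x, K x.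
Proof.
move=> sK Kb x; rewrite -[x]eval_val; elim: (val x) => [|a w IHw] /=.
  exact: subgroup1.
apply: subgroupM => //; case: a => i [] //; first by rewrite letter_basis.
have -> : letter (i, false) = (basis_elt i)^-1 by exact: val_inj.
exact: subgroupV.
Qed.

Lemma range_generated n (G : groupType) (phi : {multiplicative free_group n -> G}) :
  range phi = generated (range (phi \o @basis_elt n)).
Proof.
apply/seteqP; split; last first.
  apply: generated_sub; first exact: subgroup_range.
  by move=> _ [i _ <-]; exists (basis_elt i).
move=> _ [x _ <-].
apply: (@free_group_ind n [set x | generated (range (phi \o @basis_elt n)) (phi x)]).
  have sg := @subgroup_generated G (range (phi \o @basis_elt n)).
  apply/subgroupP; split=> [|y z gy gz|y gy] /=.
  - by rewrite group_morph1; apply: (subgroup1 sg).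
  - by rewrite gmulfM; apply: (subgroupM sg).
  - by rewrite group_morphV; apply: (subgroupV sg).
by move=> i; apply: sub_generated; exists i.
Qed.

(* Homomorphisms to Z/2 are arbitrary on a basis and determined by their values
   on generators. *)
Lemma free_generators_le n (G : groupType) (phi : {multiplicative free_group n -> G})
    (I : finType) (gen : I -> G) :
  injective phi -> range phi = generated (range gen) -> n <= #|I|.
Proof.
move=> phi_inj phi_gen.
have pre i : {x | phi x = gen i}.
  apply: cid; have : range phi (gen i) by rewrite phi_gen; apply: sub_generated; exists i.
  by case=> x _ xi; exists x.
pose F (f : {ffun 'I_n -> bool}) := [ffun i => parity f (sval (pre i))].
(* Injectivity compares the 2^n homomorphisms with the 2^#|I| tables of values on the generators. *)
suff F_inj : injective F.
  have := leq_card F F_inj; rewrite !card_ffun !card_bool card_ord.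
  by rewrite leq_exp2l.
move=> f f' eqF; apply/ffunP.
(* The two homomorphisms agree on preimages of the generators, hence K is the whole range;
   injectivity of [phi] carries this back to the basis. *)
pose K := [set g | exists2 x, phi x = g & parity f x = parity f' x].
have sK : subgroup K.
  apply/subgroupP; split=> [|_ _ [x <- ex] [y <- ey]|_ [x <- ex]].
  - by exists 1; rewrite ?group_morph1 ?parity1.
  - by exists (x * y); rewrite ?gmulfM // !parityM ex ey.
  - by exists x^-1; rewrite ?group_morphV // !parityV.
have genK : range phi `<=` K.
  rewrite phi_gen; apply: (generated_sub sK) => _ [i _ <-].
  exists (sval (pre i)); first exact: svalP (pre i).
  by move/ffunP/(_ i): eqF; rewrite !ffunE.
move=> i; have [|x /phi_inj ->] := genK (phi (basis_elt i)); first by exists (basis_elt i).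
by rewrite /parity /= !addn0 !oddb.
Qed.

Definition free_on (G : groupType) (J : set G) n : Prop :=
  exists phi : {multiplicative free_group n -> G}, injective phi /\ range phi = J.

(** The images of the basis of M together with S generate J, and [free_generators_le] bounds n by
    their number. *)
Lemma free_on_le (G : groupType) (J M : set G) n m (S : seq G) :
  free_on J n -> free_on M m -> J `<=` generated (M `|` [set` S]) ->
  M `<=` J -> [set` S] `<=` J -> n <= m + size S.
Proof.
move=> [phi [phi_inj phiJ]] [psi [_ psiM]] sJ MJ SJ.
pose gen (i : 'I_m + 'I_(size S)) : G :=
  match i with inl j => psi (basis_elt j) | inr j => tnth (in_tuple S) j end.
have genJ : range phi = generated (range gen).
  have sgJ : subgroup J by rewrite -phiJ; apply: subgroup_range.
  rewrite phiJ; apply/seteqP; split.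
    apply: subset_trans sJ _; apply: generated_sub; first exact: subgroup_generated.
    move=> x [|].
      rewrite -psiM range_generated; apply: generated_mono => _ [i _ <-].
      by exists (inl i).
    move=> /= xS; apply: sub_generated.
    by have /tnthP[i ->] : x \in in_tuple S by []; exists (inr i).
  apply: generated_sub => // _ [[i|i] _ <-] /=.
    by apply: MJ; rewrite -psiM; exists (basis_elt i).
  by apply: SJ; apply: mem_tnth.
by have := free_generators_le phi_inj genJ; rewrite card_sum !card_ord.
Qed.

Lemma free_on_inj (G : groupType) (J : set G) n m : free_on J n -> free_on J m -> n = m.
Proof.
have le n' m' : free_on J n' -> free_on J m' -> n' <= m'.
  move=> Jn Jm; have := @free_on_le _ J J n' m' [::] Jn Jm; rewrite addn0; apply=> //.
  by move=> x Jx; apply: sub_generated; left.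
by move=> Jn Jm; apply/eqP; rewrite eqn_leq !le.
Qed.

(** [xget] picks some admissible number; uniqueness of the rank pins down which. *)
Lemma rank_free_on k (J : set (free_group k)) n : free_on J n -> rank J = n.
Proof.
move=> Jn; apply: (@free_on_inj _ J _ _ _ Jn).
by apply: (@xgetPex _ 0 [set n | free_on J n]); exists n.
Qed.

End FreeRank.

(** * Spanning forests of finite graphs *)

Section FiniteGraphs.
Local Open Scope group_scope.
Local Open Scope fset_scope.
Variables (k : nat) (V : choiceType).
Implicit Types (E Tr : {fset V * 'I_k * V}) (U D : {fset V}) (x y z : V).
Implicit Types (a : 'I_k * bool) (w : seq ('I_k * bool)) (p : V -> free_group k).

(** Each edge is stored once, in its positive direction. Since edges form a finite set of triples,
    parallel edges with equal labels coincide, so identifying vertices merges them automatically. *)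
Definition arc x a y : V * 'I_k * V := if a.2 then (x, a.1, y) else (y, a.1, x).

Definition edge_step E x a y : Prop := arc x a y \in E.

Definition edge_read E := read eq (edge_step E).

Definition spans E U : Prop := forall e, e \in E -> e.1.1 \in U /\ e.2 \in U.

Definition reaches E D U : Prop :=
  forall y, y \in U -> exists2 d, d \in D & exists w, edge_read E d w y.

Lemma arc_opposite x a y : arc y (opposite a) x = arc x a y.
Proof. by case: a => i []. Qed.

Lemma arc_ends x a y U : (arc x a y).1.1 \in U -> (arc x a y).2 \in U ->
  x \in U /\ y \in U.
Proof. by case: a => i [] /=; split. Qed.

Lemma edge_automaton E : automaton eq (edge_step E).
Proof.
split=> // [x y z -> //|x _ a y _ <- <- //|x a y].
by rewrite /edge_step arc_opposite.
Qed.

Lemma edge_read_sub E E' x w y : E `<=` E' -> edge_read E x w y -> edge_read E' x w y.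
Proof. by move=> /fsubsetP EE'; apply: read_mono => // ? ? ? /EE'. Qed.

Lemma edge_read_coset L E p x w y : subgroup L ->
  (forall e, e \in E -> same_coset L (p e.1.1 * basis_elt e.1.2) (p e.2)) ->
  edge_read E x w y -> same_coset L (p x * eval w) (p y).
Proof.
move=> sL EL; apply: read_same_coset => // {x y} [x _ <-|x [i []] y /EL] /=.
- exact: same_coset_refl.
- by rewrite letter_basis.
move=> xy; rewrite -(same_cosetM _ _ _ (basis_elt i)) -mulgA.
by rewrite (letter_opposite (i, true)) letter_basis mulVg mulg1; apply: same_coset_sym.
Qed.

Lemma edge_exit E D x w y : edge_read E x w y -> x \in D -> y \notin D ->
  exists x' a z, [/\ x' \in D, z \notin D & edge_step E x' a z].
Proof.
elim: w x => [|a w IHw] x /=; first by move=> <- ->.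
case=> z xz zy xD yD; have [zD|zD] := boolP (z \in D); first exact: IHw zy zD yD.
by exists x, a, z.
Qed.

(** The forest grows from D one vertex at a time, along an arc by which some walk leaves D. The
    potential p is extended so that every forest arc carries exactly its label; forest arcs never
    join two vertices of D, which later keeps them apart from the arcs of a core on D. *)
Lemma spanning_forest E U D p : D `<=` U -> spans E U -> reaches E D U ->
  exists Tr p', [/\ Tr `<=` E, #|` Tr| = #|` U `\` D|,
      forall e, e \in Tr -> ~ (e.1.1 \in D /\ e.2 \in D),
      {in D, p' =1 p} /\ (forall e, e \in Tr -> p' e.1.1 * basis_elt e.1.2 = p' e.2) &
      forall y, y \in U -> exists2 d, d \in D &
        exists2 w, edge_read Tr d w y & p' y = p d * eval w].
Proof.
move=> DU EU; move cardUD: #|` U `\` D| => n.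
elim: n D p DU cardUD => [|n IHn] D p DU cardUD ED.
  exists fset0, p; split=> //.
  move=> y yU; exists y; last by exists [::]; rewrite ?mulg1.
  by move/cardfs0_eq/fsetP/(_ y): cardUD; rewrite !inE yU andbT => /negbFE.
have [y yUD] : exists y, y \in U `\` D by apply/fset0Pn; rewrite -cardfs_gt0 cardUD.
have /fsetDP[yU yD] := yUD.
have [d dD [w]] := ED y yU => /edge_exit/(_ dD yD)[x [a [z [xD zD xz]]]].
have [zU1 zU2] := EU _ xz; have [xU zU] := arc_ends zU1 zU2.
(* The new vertex gets the value that the arc from x forces. *)
pose p1 v := if v == z then p x * letter a else p v.
have zDU : z |` D `<=` U by rewrite fsubUset fsub1set zU.
have card_zD : #|` U `\` (z |` D)| = n.
  have -> : U `\` (z |` D) = (U `\` D) `\ z.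
    by apply/fsetP=> v; rewrite !inE negb_or andbA.
  by move: cardUD; rewrite (cardfsD1 z) !inE zU zD /= add1n => -[].
have reach_zD : reaches E (z |` D) U.
  move=> v /ED[d' d'D [w' d'v]]; exists d'; last by exists w'.
  by rewrite !inE d'D orbT.
have [Tr [p' [TrE cardTr TrD [p'D p'E] p'w]]] := IHn _ p1 zDU card_zD reach_zD.
have xzTr : arc x a z \notin Tr.
  apply/negP=> /TrD; apply; case: (a) => i [] /=; split; rewrite !inE ?eqxx ?xD ?orbT //.
have p'x : p' x = p x.
  by rewrite p'D ?inE ?xD ?orbT // /p1; case: eqP zD => // <-; rewrite xD.
have p'z : p' z = p x * letter a by rewrite p'D ?inE ?eqxx // /p1 eqxx.
exists (arc x a z |` Tr), p'; split.
- by rewrite fsubUset fsub1set; apply/andP.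
- by rewrite cardfsU1 xzTr cardTr.
- move=> e; rewrite !inE => /predU1P[-> [xD' zD']|/TrD h [eD1 eD2]].
    by have [_] := arc_ends xD' zD'; apply/negP.
  by apply: h; rewrite !inE eD1 eD2 !orbT.
- split=> [v vD|e].
    by rewrite p'D ?inE ?vD ?orbT // /p1; case: eqP zD => // <-; rewrite vD.
  rewrite !inE => /predU1P[->|/p'E //]; rewrite /arc.
  case: (a) p'z => i [] /= p'z; rewrite p'x p'z ?letter_basis //.
  by rewrite (letter_opposite (i, true)) letter_basis mulgVK.
move=> v /p'w[d' d'D [w' d'v eqp]].
have TrS : Tr `<=` arc x a z |` Tr by exact: fsubsetUr.
move: d'D; rewrite !inE /p1 in eqp * => /predU1P[eqd|d'D].
  rewrite eqd eqxx -mulgA in eqp; exists x => //; exists (a :: w') => //=.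
  exists z; first by rewrite /edge_step !inE eqxx.
  by rewrite eqd in d'v; exact: edge_read_sub TrS d'v.
exists d' => //; exists w'; first exact: edge_read_sub TrS d'v.
by move: eqp; case: eqP zD => // <-; rewrite d'D.
Qed.

(* Collapsing a spanning forest over D removes as many arcs as there are
   vertices outside D; each further arc contributes one generator. *)
Lemma graph_generators E E0 U D p h (N J : set (free_group k)) :
  D `<=` U -> spans E U -> spans E0 D -> reaches E D U ->
  subgroup N -> subgroup J -> (N `<=` J)%classic ->
  (forall e, e \in E -> same_coset J (h e.1.1 * basis_elt e.1.2) (h e.2)) ->
  (forall d, d \in D -> same_coset J (p d) (h d)) ->
  (forall e, e \in E0 -> same_coset N (p e.1.1 * basis_elt e.1.2) (p e.2)) ->
  exists S : seq (free_group k), exists p',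
    [/\ ([set` S] `<=` J)%classic, size S + #|` U `\` D| <= #|` E `\` E0|,
        {in D, p' =1 p} &
        forall x w y, edge_read E x w y ->
          same_coset (generated (N `|` [set` S])%classic) (p' x * eval w) (p' y)].
Proof.
move=> DU EU E0D ED sN sJ NJ hE hD pE0.
have [Tr [p' [TrE cardTr TrD [p'D p'E] p'w]]] := spanning_forest p DU EU ED.
(* The discrepancy of the potential along e: it is trivial on forest arcs and lies in N on [E0], so
   only the remaining arcs give generators. *)
pose gen (e : V * 'I_k * V) := p' e.1.1 * basis_elt e.1.2 * (p' e.2)^-1.
exists [seq gen e | e <- (E `\` E0) `\` Tr], p'.
have TrE0 : Tr `<=` E `\` E0.
  apply/fsubsetP=> e eTr; rewrite inE (fsubsetP TrE) // andbT.
  by apply/negP=> /E0D; apply: TrD.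
have p'h y : y \in U -> same_coset J (p' y) (h y).
  move=> /p'w[d dD [w dy ->]].
  apply: (same_coset_trans sJ) (edge_read_coset sJ hE (edge_read_sub TrE dy)).
  by apply/same_cosetM/hD.
split=> //.
- move=> _ /mapP[e + ->]; rewrite !inE => /and3P[_ _ eE].
  have [eU1 eU2] := EU e eE; rewrite -/(same_coset J _ _).
  apply: (same_coset_trans sJ) (same_coset_sym sJ (p'h _ eU2)).
  apply: (same_coset_trans sJ) (hE e eE); exact/same_cosetM/p'h.
- rewrite size_map -cardTr -[size _]/(#|` (E `\` E0) `\` Tr|) cardfsDS // subnK //.
  exact: fsubset_leq_card.
set N' := generated _; have sN' : subgroup N' by exact: subgroup_generated.
move=> x w y; apply: edge_read_coset => // e eE.
have [eTr|eTr] := boolP (e \in Tr); first by rewrite p'E //; apply: same_coset_refl.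
have [eE0|eE0] := boolP (e \in E0).
  have [eD1 eD2] := E0D e eE0.
  by rewrite !p'D //; apply: sub_generated; left; apply: pE0.
apply: sub_generated; right => /=; apply/mapP; exists e => //.
by rewrite !inE eTr eE0.
Qed.

(** The fundamental group of a connected graph is free on the arcs outside a spanning tree, of which
    there are #|E| - (#|U| - 1). Determinism identifies it with a subgroup of the free group. *)
Lemma free_on_graph E U b (J : set (free_group k)) :
  b \in U -> spans E U -> reaches E [fset b] U ->
  deterministic eq (edge_step E) ->
  (forall g, J g <-> edge_read E b (val g) b) ->
  exists2 n, free_on J n & (n + #|` U| = #|` E|.+1)%N.
Proof.
move=> bU EU Eb Edet JE.
have bsub : [fset b] `<=` U by rewrite fsub1set.
have [Tr [p [TrE cardTr TrD [pb pE] pw]]] := spanning_forest (fun=> 1) bsub EU Eb.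
have {}pb : p b = 1 by rewrite pb ?inE.
have {}pw y : y \in U -> exists2 w, edge_read Tr b w y & p y = eval w.
  by move=> /pw[_ /fset1P -> [w bw ->]]; exists w; rewrite ?mul1g.
have aE := edge_automaton E.
pose s := enum_fset (E `\` Tr).
have mem_s e : (e \in s) = (e \in E) && (e \notin Tr).
  by rewrite -[LHS]/(e \in E `\` Tr) in_fsetD andbC.
pose n := size s.
(* Tree arcs have no index in s, and then c takes the value 1. *)
pose c (e : V * 'I_k * V) : free_group n :=
  if insub (index e s) is Some j then basis_elt j else 1.
pose gen (j : 'I_n) : free_group k :=
  let e := tnth (in_tuple s) j in p e.1.1 * basis_elt e.1.2 * (p e.2)^-1.
have cTr e : e \in Tr -> c e = 1.
  move=> eTr; rewrite /c insubF //; apply/negbTE.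
  by rewrite index_mem mem_s eTr andbF.
have c_tnth j : c (tnth (in_tuple s) j) = basis_elt j.
  rewrite /c; set e := tnth _ _.
  have -> : index e s = j by rewrite /e (tnth_nth e) index_uniq // fset_uniq.
  by rewrite insubT //= => lt_j; congr basis_elt; apply: val_inj.
have [phi phi_basis] : exists phi : {multiplicative free_group n -> free_group k},
    forall j, phi (basis_elt j) = gen j.
  by exists (free_lift gen) => j; apply: free_lift_basis.
have phi_c e : e \in E -> phi (c e) = p e.1.1 * basis_elt e.1.2 * (p e.2)^-1.
  move=> eE; have [eTr|eTr] := boolP (e \in Tr).
    by rewrite cTr // group_morph1 pE // mulgV.
  have /tnthP[j ->] : e \in in_tuple s by rewrite mem_s eE.
  by rewrite c_tnth phi_basis.
have sJ : subgroup J.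
  have -> : J = [set g : free_group k | edge_read E b (val g) b]%classic.
    by apply/seteqP; split=> g /JE.
  exact: subgroup_read.
have loop j : exists w1 w2, let e := tnth (in_tuple s) j in
    [/\ edge_read Tr b w1 e.1.1, edge_read Tr b w2 e.2, e \in E &
        eval (w1 ++ (e.1.2, true) :: inverse_word w2) = gen j].
  have : tnth (in_tuple s) j \in s by apply: mem_tnth.
  rewrite mem_s => /andP[eE _]; have [/pw[w1 r1 p1] /pw[w2 r2 p2]] := EU _ eE.
  exists w1, w2; split=> //.
  by rewrite eval_cat /= eval_inverse -p1 -p2 letter_basis mulgA.
have read_loop w1 w2 e : edge_read E b w1 e.1.1 -> edge_read E b w2 e.2 -> e \in E ->
    edge_read E b (w1 ++ (e.1.2, true) :: inverse_word w2) b.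
  move=> r1 r2 eE; apply/(read_cat aE); exists e.1.1 => //=.
  exists e.2; last exact: read_inverse.
  by rewrite /edge_step /arc /=; case: (e) eE => [[]].
have phiJ : (range phi `<=` J)%classic.
  rewrite range_generated; apply: (generated_sub sJ) => _ [j _ <-] /=.
  rewrite phi_basis; have [w1 [w2 [r1 r2 eE <-]]] := loop j.
  apply/JE/(read_eval aE Edet)/read_loop => //.
    exact: edge_read_sub TrE r1.
  exact: edge_read_sub TrE r2.
have Jphi : (J `<=` range phi)%classic.
  (* Along each arc p changes by a value of [phi]; over a loop at b these changes multiply to g. *)
  have step x w y : edge_read E x w y -> exists u, p x * eval w = phi u * p y.
    elim: w x => [|a w IHw] x /=; first by move=> ->; exists 1; rewrite group_morph1 mulg1 mul1g.
    move=> [z xz /IHw[u eqz]].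
    have [v eqv] : exists v, p x * letter a = phi v * p z.
      have := phi_c _ xz; rewrite /arc; case: (a) => i [] /= eqc.
        by exists (c (x, i, z)); rewrite eqc letter_basis mulgVK.
      exists (c (z, i, x))^-1; rewrite group_morphV eqc !invgM invgK.
      by rewrite (letter_opposite (i, true)) letter_basis mulgA mulgVK.
    by exists (v * u); rewrite mulgA eqv -mulgA eqz gmulfM mulgA.
  by move=> g /JE/step[u]; rewrite eval_val pb mul1g mulg1 => ->; exists u.
pose clab x a y := if a.2 then c (arc x a y) else (c (arc x a y))^-1.
(* A covering of the graph: the second component records the non-tree arcs crossed. Some word for
   [phi u] moves (b, v) to (b, v * u). The covering is deterministic, so a word with trivial value
   returns to its start; hence [phi u = 1] forces u = 1. *)
pose T (xu : V * free_group n) a (yv : V * free_group n) :=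
  edge_step E xu.1 a yv.1 /\ yv.2 = xu.2 * clab xu.1 a yv.1.
have clab_opp x a y : clab y (opposite a) x = (clab x a y)^-1.
  by rewrite /clab arc_opposite; case: (a) => i [] /=; rewrite ?invgK.
have aT : automaton eq T.
  split=> // [x y z -> //|x _ a y _ <- <- //|x a y [xy eqy]]; split.
    exact: step_opposite aE _ _ _ xy.
  by rewrite clab_opp eqy mulgK.
have dT : deterministic eq T.
  move=> [x u] a [y v] [z t] [/= xy ->] [/= xz ->].
  by rewrite (Edet _ _ _ _ xy xz).
have readTr x v w y : edge_read Tr x w y -> read eq T (x, v) w (y, v).
  elim: w x => [|a w IHw] x /=; first by move=> ->.
  move=> [z xz zy]; exists (z, v); last exact: IHw.
  split=> /=; first exact: (fsubsetP TrE).
  by rewrite /clab cTr // invg1 if_same mulg1.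
have phi_read u v : exists2 w, eval w = phi u & read eq T (b, v) w (b, v * u).
  move: u v; apply: (@free_group_ind n
    [set u | forall v, exists2 w, eval w = phi u & read eq T (b, v) w (b, v * u)]%classic).
    apply/subgroupP; split=> [v|u1 u2 h1 h2 v|u h v] /=.
    - by exists [::]; rewrite /= ?group_morph1 ?mulg1.
    - have [w1 e1 r1] := h1 v; have [w2 e2 r2] := h2 (v * u1).
      exists (w1 ++ w2); first by rewrite eval_cat e1 e2 gmulfM.
      by apply/(read_cat aT); exists (b, v * u1) => //; rewrite mulgA.
    have [w ew rw] := h (v * u^-1); exists (inverse_word w).
      by rewrite eval_inverse ew group_morphV.
    by apply: (read_inverse aT); move: rw; rewrite mulgVK.
  move=> j v /=; have [w1 [w2 [r1 r2 eE eqg]]] := loop j.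
  exists (w1 ++ ((tnth (in_tuple s) j).1.2, true) :: inverse_word w2).
    by rewrite eqg phi_basis.
  apply/(read_cat aT); exists ((tnth (in_tuple s) j).1.1, v); first exact: readTr.
  exists ((tnth (in_tuple s) j).2, v * basis_elt j).
    rewrite -c_tnth /T /edge_step /clab /=.
    by case: (tnth _ _) eE => [[]].
  by apply: (read_inverse aT); apply: readTr.
exists n.
  exists phi; split; last by apply/seteqP.
  move=> u v eq_uv; have [w ew rw] := phi_read (u * v^-1) 1.
  have e0 : eval w = eval [::] by rewrite ew gmulfM group_morphV eq_uv mulgV.
  have eq2 := read_eval_eq aT dT rw (erefl : read eq T (b, 1) [::] (b, 1)) e0.
  by rewrite mul1g in eq2; apply: divg1_eq; have := congr1 snd eq2; apply.
rewrite /n /s -[size _]/(#|` _|) cardfsDS // cardTr cardfsDS // cardfs1.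
have U_gt0 : 0 < #|` U| by rewrite cardfs_gt0; apply/fset0Pn; exists b.
have TrleE := fsubset_leq_card TrE; rewrite cardTr cardfsDS // cardfs1 in TrleE.
by lia.
Qed.

End FiniteGraphs.

(** * Finite models of core graphs *)

Section CoreModels.
Local Open Scope group_scope.
Local Open Scope fset_scope.
Variables (k : nat) (V : choiceType).
Implicit Types (E : {fset V * 'I_k * V}) (U D : {fset V}) (d : V).
Implicit Types (a : 'I_k * bool) (w : seq ('I_k * bool)) (p : V -> free_group k).
Implicit Types (L M J : set (free_group k)) (x y z : free_group k).

(* (D, E) is a copy of the core of L, the vertex d standing for the coset L (p d). *)
Record core_model L p D E : Prop := CoreModel {
  model_vertex : forall x, core_vertex L x -> exists2 d, d \in D & same_coset L x (p d);
  model_core : forall d, d \in D -> core_vertex L (p d);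
  model_inj : forall d d', d \in D -> d' \in D -> same_coset L (p d) (p d') -> d = d';
  model_edge : forall e, e \in E <->
    [/\ e.1.1 \in D, e.2 \in D, core_edge L (p e.1.1) (e.1.2, true) &
        same_coset L (p e.1.1 * basis_elt e.1.2) (p e.2)] }.

Section Model.
Variables (L : set (free_group k)) (p : V -> free_group k).
Variables (D : {fset V}) (E : {fset V * 'I_k * V}).
Hypotheses (sL : subgroup L) (mL : core_model L p D E).

Lemma model_spans : spans E D.
Proof. by move=> e /(model_edge mL)[]. Qed.

Lemma model_edge_coset e : e \in E ->
  same_coset L (p e.1.1 * basis_elt e.1.2) (p e.2).
Proof. by move=> /(model_edge mL)[]. Qed.

Lemma model_step d a d' : d \in D -> d' \in D ->
  edge_step E d a d' <-> core_step L (p d) a (p d').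
Proof.
move=> dD d'D; case: a => i [].
  split=> [/(model_edge mL)[_ _ ? ?]|[? ?]]; first by split.
  by apply/(model_edge mL); split.
split=> [/(model_edge mL)[_ _ /= h1 h2]|h].
  apply: (step_opposite (core_automaton sL) (a := (i, true))).
  by split.
have [h1 h2] := step_opposite (core_automaton sL) h.
by apply/(model_edge mL); split.
Qed.

Lemma model_deterministic : deterministic eq (edge_step E).
Proof.
move=> d a d1 d2 h1 h2.
have [/= eD1 eD2] := model_spans h1; have [dD d1D] := arc_ends eD1 eD2.
have [/= eD3 eD4] := model_spans h2; have [_ d2D] := arc_ends eD3 eD4.
apply: (model_inj mL) => //.
exact: core_deterministic sL _ _ _ _ (iffLR (model_step a dD d1D) h1)
  (iffLR (model_step a dD d2D) h2).
Qed.

Lemma model_base : exists2 b, b \in D & L (p b).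
Proof.
have [b bD h] := model_vertex mL (or_introl (same_coset_refl sL 1)).
by exists b => //; apply/same_coset1l.
Qed.

Lemma model_read x w y d : core_read L x w y -> d \in D -> same_coset L x (p d) ->
  exists2 d', edge_read E d w d' & d' \in D /\ same_coset L y (p d').
Proof.
elim: w x d => [|a w IHw] x d /=.
  move=> xy dD xd; exists d => //; split=> //.
  exact: same_coset_trans (same_coset_sym sL xy) xd.
move=> [z xz zy] dD xd; have [xa xaz] := xz.
have [d1 d1D zd1] : exists2 d1, d1 \in D & same_coset L z (p d1).
  apply: (model_vertex mL); apply: core_vertex_compat xaz _ => //.
  exact: core_vertex_end.
have [d' d1d' d'D] := IHw _ _ zy d1D zd1.
exists d' => //; exists d1 => //; apply/(model_step a dD d1D).
exact: step_compat (core_automaton sL) _ _ _ _ _ xd zd1 xz.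
Qed.

Lemma model_read_coset d w d' : edge_read E d w d' ->
  same_coset L (p d * eval w) (p d').
Proof. exact: edge_read_coset sL model_edge_coset. Qed.

Variable b : V.
Hypotheses (bD : b \in D) (Lb : L (p b)).

Lemma model_reaches : reaches E [fset b] D.
Proof.
move=> d dD; exists b; first by rewrite inE.
have [w /model_read/(_ bD)[]] := core_vertex_read sL (model_core mL dD).
  exact/same_coset1l.
move=> d' bd' [d'D /(model_inj mL dD d'D) ->].
by exists w.
Qed.

Lemma model_loop g : L g <-> edge_read E b (val g) b.
Proof.
split=> [Lg|/model_read_coset]; last first.
  by rewrite eval_val; apply: same_coset_absorb.
have [b' h [b'D]] := model_read (core_read_val sL Lg) bD (iffRL (same_coset1l sL _) Lb).
move/(same_coset1l sL) => Lb'; rewrite [X in edge_read _ _ _ X](_ : b = b') //.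
by apply: (model_inj mL) => //; apply: same_coset_mem.
Qed.

End Model.

Lemma model_free L p D E : subgroup L -> core_model L p D E ->
  exists2 n, free_on L n & (n + #|` D| = #|` E|.+1)%N.
Proof.
move=> sL mL; have [b bD Lb] := model_base sL mL.
apply: (free_on_graph bD (model_spans mL)); first exact: (model_reaches sL mL bD Lb).
  exact: (model_deterministic sL mL).
exact: (model_loop sL mL bD Lb).
Qed.

End CoreModels.

(** * Choosing finite models, and free factors from embedded cores *)

Section FreeFactors.
Local Open Scope group_scope.
Local Open Scope fset_scope.
Variable k : nat.
Implicit Types (L M J : set (free_group k)) (x y : free_group k).

Lemma finite_core_model L : subgroup L -> finite_core L ->
  exists D E, core_model L (@fst (free_group k) nat) D E.
Proof.
move=> sL [C coreC].
have [r [rC rD]] : exists r : seq (free_group k),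
    (forall x, core_vertex L x -> exists2 c, c \in r & same_coset L x c) /\
    (forall c c', c \in r -> c' \in r ->
       core_vertex L c /\ (same_coset L c c' -> c = c')).
  (* For the induction on C, r need only represent the core vertices that C represents. *)
  suff [r [rC rD]] : exists r : seq (free_group k),
      (forall x, core_vertex L x -> (exists2 c, c \in C & same_coset L x c) ->
         exists2 c, c \in r & same_coset L x c) /\
      (forall c c', c \in r -> c' \in r ->
         core_vertex L c /\ (same_coset L c c' -> c = c')).
    by exists r; split=> // x xV; apply: rC => //; apply: coreC.
  elim: C {coreC} => [|c0 C [r [rC rD]]]; first by exists [::]; split=> // x _ [].
  have [c0V|c0V] := pselect (core_vertex L c0); last first.
    exists r; split=> // x xV [c]; rewrite inE => /predU1P[-> xc|cC xc].
      by case: c0V; apply: core_vertex_compat xc xV.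
    by apply: rC => //; exists c.
  have [[c1 c1r c01]|c0r] := pselect (exists2 c, c \in r & same_coset L c0 c).
    exists r; split=> // x xV [c]; rewrite inE => /predU1P[-> xc|cC xc].
      by exists c1 => //; apply: same_coset_trans c01.
    by apply: rC => //; exists c.
  exists (c0 :: r); split=> [x xV [c]|c c'].
    rewrite inE => /predU1P[-> xc|cC xc]; first by exists c0; rewrite ?inE ?eqxx.
    have [|c' c'r xc'] := rC x xV; first by exists c.
    by exists c'; rewrite // inE c'r orbT.
  rewrite !inE => /predU1P[->|cr] /predU1P[->|c'r]; split=> //.
  - by move=> h; case: c0r; exists c'.
  - by have [] := rD c c cr cr.
  - by move=> h; case: c0r; exists c => //; apply: same_coset_sym.
  - by have [] := rD c c' cr c'r.
  - by have [_] := rD c c' cr c'r.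
(* The numerical component leaves room for further vertices over the same coset, as petals will
   require. *)
pose D : {fset free_group k * nat} := [fset (c, 0) | c in r].
have memD c : (c \in D) = (c.1 \in r) && (c.2 == 0).
  apply/imfsetP/andP => [[c' /= c'r ->] //|[cr /eqP c0]].
  by exists c.1; rewrite // -c0; case: (c).
pose E : {fset (free_group k * nat) * 'I_k * (free_group k * nat)} :=
  [fset e in (D `*` [fset i in enum 'I_k]) `*` D |
    `[< core_edge L e.1.1.1 (e.1.2, true) /\
        same_coset L (e.1.1.1 * basis_elt e.1.2) e.2.1 >]].
exists D, E; split=> [x /rC[c cr xc]|d|d d'|e].
- by exists (c, 0); rewrite // memD /= cr eqxx.
- by rewrite memD => /andP[dr _]; have [] := rD _ _ dr dr.
- rewrite !memD => /andP[dr /eqP d0] /andP[d'r /eqP d'0] /(rD _ _ dr d'r).2.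
  by case: d d' d0 d'0 {dr d'r} => [? ?] [? ?] /= -> -> ->.
rewrite 2!inE /= !in_fsetM inE /= mem_enum inE andbT; split.
  by move=> /andP[/andP[-> ->] /asboolP[]].
by move=> [-> -> ? ?]; apply/asboolP.
Qed.

(** Injectivity of the core morphism on vertices; on edges it follows, since origin and label
    determine an edge. *)
Definition core_embeds L J : Prop := forall x y,
  core_vertex L x -> core_vertex L y -> same_coset J x y -> same_coset L x y.

(* If the core of M embeds in that of J, a spanning tree of the former extends
   to one of the latter, so M is a free factor of J. *)
Lemma free_factor_generators M J :
  subgroup M -> subgroup J -> (M `<=` J)%classic -> finite_core J ->
  core_embeds M J ->
  exists n m (S : seq (free_group k)), [/\ free_on J n, free_on M m,
    ([set` S] `<=` J)%classic, (J `<=` generated (M `|` [set` S]))%classic &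
    (size S + m <= n)%N].
Proof.
move=> sM sJ MJ fJ embMJ; have [U [E mJ]] := finite_core_model sJ fJ.
pose V := (free_group k * nat)%type.
pose over (d : V) := [set x | core_vertex M x /\ same_coset J x d.1]%classic.
(* A core vertex of M in the J-coset of d; where none exists the default 1 is taken, and such d are
   excluded from D. *)
pose p (d : V) := xget 1 (over d).
pose D := [fset d in U | `[< exists x, over d x >]].
have memD d : d \in D -> [/\ d \in U, core_vertex M (p d) & same_coset J (p d) d.1].
  by rewrite !inE /= => /andP[dU /asboolP /(xgetPex 1)[]].
pose E0 := [fset e in E | (e.1.1 \in D) && (e.2 \in D) &&
  `[< core_edge M (p e.1.1) (e.1.2, true) /\
        same_coset M (p e.1.1 * basis_elt e.1.2) (p e.2) >]].
have mM : core_model M p D E0.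
  split=> [x xV|d|d d'|e].
  - have [d dU xd] := model_vertex mJ (core_vertex_sub MJ xV).
    have dD : d \in D by rewrite !inE dU; apply/asboolP; exists x.
    exists d => //; have [_ pdV pdd] := memD d dD.
    by apply: embMJ => //; apply: same_coset_trans (same_coset_sym sJ pdd).
  - by move=> /memD[].
  - move=> /memD[dU _ pd] /memD[d'U _ pd'] pdd'; apply: (model_inj mJ) => //.
    apply: (same_coset_trans sJ) pd'; apply: (same_coset_trans sJ) (MJ _ pdd').
    exact: same_coset_sym.
  - rewrite 2!inE /=; split; first by case/andP=> _ /andP[/andP[-> ->] /asboolP[]].
    move=> [e1D e2D h1 h2]; rewrite e1D e2D /= andbC; apply/andP; split.
      by apply/asboolP.
    have [e1U _ pe1] := memD _ e1D; have [e2U _ pe2] := memD _ e2D.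
    apply/(model_edge mJ); split=> //.
      exact: core_edge_compat pe1 (core_edge_sub MJ h1).
    apply: (same_coset_trans sJ) pe2; apply: (same_coset_trans sJ) (MJ _ h2).
    by apply/same_cosetM; apply: same_coset_sym.
have [b bD Mb] := model_base sM mM.
have [bU _ pb] := memD b bD.
have Jb : J b.1.
  apply/(same_coset1l sJ); apply: (same_coset_trans sJ) pb.
  exact/(same_coset1l sJ)/MJ.
have DU : D `<=` U by apply/fsubsetP=> d /memD[].
have E0E : E0 `<=` E by apply/fsubsetP=> e; rewrite 2!inE /= => /andP[].
have reachU : reaches E D U.
  by move=> y /(model_reaches sJ mJ bU Jb)[_ /fset1P -> ry]; exists b.
have [S [p' [SJ cardS p'D p'E]]] := graph_generators DU (model_spans mJ) (model_spans mM)
  reachU sM sJ MJ (model_edge_coset mJ) (fun d dD => let: And3 _ _ h := memD d dD in h)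
  (model_edge_coset mM).
have [n Jn cardJ] := model_free sJ mJ; have [m Mm cardM] := model_free sM mM.
exists n, m, S; split=> //; last first.
  (* Here n = #|E| - #|U| + 1 and m = #|E0| - #|D| + 1, so n - m is exactly the number of arcs minus
     vertices outside the core of M. *)
  have := fsubset_leq_card DU; have := fsubset_leq_card E0E.
  by move: cardS; rewrite !cardfsDS //; lia.
set N := generated _; have sN : subgroup N by exact: subgroup_generated.
move=> g /(model_loop sJ mJ bU Jb)/p'E; rewrite eval_val p'D // -/N => Ng.
have Nb : N (p b) by apply: sub_generated; left.
exact: (same_coset_absorb sN Nb).
Qed.

End FreeFactors.

(** * Folding petals *)

Section Folding.
Local Open Scope group_scope.
Local Open Scope fset_scope.
Variable k : nat.
Local Notation V := (free_group k * nat)%type.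
Implicit Types (E : {fset V * 'I_k * V}) (U D : {fset V}) (u v : V).
Implicit Types (a : 'I_k * bool) (w : seq ('I_k * bool)).
Implicit Types (L J N : set (free_group k)) (x y : free_group k).

(* The first component of a vertex places it over a coset of J. *)
Definition over J E : Prop :=
  forall e, e \in E -> same_coset J (e.1.1.1 * basis_elt e.1.2) e.2.1.

Lemma over_arc J u a v : subgroup J -> same_coset J (u.1 * letter a) v.1 ->
  same_coset J ((arc u a v).1.1.1 * basis_elt (arc u a v).1.2) (arc u a v).2.1.
Proof.
move=> sJ; case: a => i [] /=; first by rewrite letter_basis.
rewrite (letter_opposite (i, true)) letter_basis => h; apply: same_coset_sym => //.
by rewrite -(same_cosetM _ _ _ (basis_elt i)) mulgVK in h.
Qed.

(** Every letter but the last brings one arc and one new vertex. The last brings at most one arc, so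
    E - V grows by at most 1. *)
Lemma attach_path J E U u a w v :
  subgroup J -> over J E -> spans E U -> u \in U -> v \in U ->
  same_coset J (u.1 * eval (a :: w)) v.1 ->
  exists E' U', [/\ E `<=` E', U `<=` U', spans E' U' /\ over J E',
    edge_read E' u (a :: w) v /\ reaches E' U U' &
    (#|` E'| + #|` U| <= #|` E| + #|` U'| + 1)%N].
Proof.
move=> sJ; elim: w a u E U => [|a' w IHw] a u E U EJ EU uU vU uv.
  exists (arc u a v |` E), U; split=> //; first exact: fsubsetUr.
  - split=> e; rewrite !inE => /predU1P[->|].
    + by rewrite /arc; case: (a) => i [].
    + exact: EU.
    + by apply: over_arc => //; move: uv; rewrite /= mulg1.
    + exact: EJ.
  - split; first by exists v => //; rewrite /edge_step !inE eqxx.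
    by move=> y yU; exists y => //; exists [::].
  - by rewrite cardfsU1; case: (_ \notin _) => /=; lia.
(* Fresh because its second component exceeds that of every vertex of U. *)
pose z : V := (u.1 * letter a, (\sum_(y <- U) y.2).+1).
have zU : z \notin U.
  apply/negP=> zU; have : z.2 <= \sum_(y <- U) y.2.
    by rewrite (big_fsetD1 z) //= leq_addr.
  by rewrite /= ltnn.
pose E1 := arc u a z |` E.
have E1U : spans E1 (z |` U).
  move=> e; rewrite !inE => /predU1P[->|/EU[-> ->]]; last by rewrite !orbT.
  by rewrite /arc; case: (a) => i [] /=; rewrite uU eqxx ?orbT.
have E1J : over J E1.
  move=> e; rewrite !inE => /predU1P[->|/EJ//].
  by apply: over_arc => //; apply: same_coset_refl.
have [|||E' [U' [E'E U'U [E'U' E'J] [zv E'w] cardE']]] := IHw a' z E1 (z |` U) E1J E1U.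
- by rewrite !inE eqxx.
- by rewrite !inE vU orbT.
- by move: uv; rewrite /= -!mulgA.
have uz : edge_step E' u a z by apply: (fsubsetP E'E); rewrite !inE eqxx.
exists E', U'; split=> //.
- by apply: fsubset_trans E'E; apply: fsubsetUr.
- by apply: fsubset_trans U'U; apply: fsubsetUr.
- split; first by exists z.
  move=> y /E'w[d]; rewrite !inE => /predU1P[->|dU] [w' dy]; last by exists d => //; exists w'.
  by exists u => //; exists (a :: w'); exists z.
by move: cardE'; rewrite !cardfsU1 zU; case: (_ \notin _) => /=; lia.
Qed.

Lemma attach_petals J E U b (S : seq (free_group k)) :
  subgroup J -> over J E -> spans E U -> b \in U -> J b.1 ->
  reaches E [fset b] U -> ([set` S] `<=` J)%classic ->
  exists E' U', [/\ E `<=` E', U `<=` U', spans E' U' /\ over J E',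
    reaches E' [fset b] U' /\ (forall s, s \in S -> edge_read E' b (val s) b) &
    (#|` E'| + #|` U| <= #|` E| + #|` U'| + size S)%N].
Proof.
move=> sJ EJ EU bU Jb Eb; elim: S => [|s S IHS] SJ.
  by exists E, U; split=> //; rewrite addn0.
have [|E1 [U1 [EE1 UU1 [E1U1 E1J] [E1b E1S] card1]]] := IHS.
  by move=> x /= xS; apply: SJ; rewrite /= inE xS orbT.
have Js : J s by apply: SJ; rewrite /= inE eqxx.
(* A trivial generator needs no petal; [attach_path] treats nonempty words only. *)
case eqs : (val s) => [|a w].
  exists E1, U1; split=> //; last by move: card1 => /=; lia.
  by split=> // s'; rewrite inE => /predU1P[->|/E1S //]; rewrite eqs.
have bU1 := fsubsetP UU1 _ bU.
have [|E2 [U2 [E12 U12 [E2U2 E2J] [bb E2w] card2]]] := attach_path sJ E1J E1U1 bU1 bU1 (a := a) (w := w).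
  by rewrite -eqs eval_val; apply: same_coset_mem => //; apply: subgroupM.
exists E2, U2; split=> //; [exact: fsubset_trans E12|exact: fsubset_trans U12| |].
- split=> [y /E2w[d /E1b[_ /fset1P -> [w1 bd]] [w2 dy]]|s'].
    exists b; rewrite ?inE //; exists (w1 ++ w2).
    apply/(read_cat (edge_automaton E2)); exists d => //.
    exact: edge_read_sub E12 bd.
  rewrite inE => /predU1P[->|/E1S]; first by rewrite eqs.
  exact: edge_read_sub.
- by move: card1 card2 => /=; lia.
Qed.

Definition identify u v t : V := if t == v then u else t.

Definition identify_edge u v (e : V * 'I_k * V) : V * 'I_k * V :=
  (identify u v e.1.1, e.1.2, identify u v e.2).

Section Identify.
Variables (u v : V).
Hypothesis uv : u != v.
Local Notation f := (identify u v).
Local Notation fe := (identify_edge u v).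

Lemma identify_arc t a t' : fe (arc t a t') = arc (f t) a (f t').
Proof. by case: a => i []. Qed.

Lemma identify_id t : t != v -> f t = t.
Proof. by rewrite /identify => /negPf->. Qed.

Lemma identifyE : f v = u.
Proof. by rewrite /identify eqxx. Qed.

Lemma identify_in U t : u \in U -> t \in U -> f t \in U `\ v.
Proof.
by move=> uU tU; rewrite !inE /identify; case: ifPn => [_|->]; rewrite ?uv ?uU ?tU.
Qed.

Lemma identify_spans E U : u \in U -> spans E U -> spans (fe @` E) (U `\ v).
Proof.
by move=> uU EU e /imfsetP[/= e' /EU[eU1 eU2] ->]; split; apply: identify_in.
Qed.

Lemma identify_read E t w t' : edge_read E t w t' -> edge_read (fe @` E) (f t) w (f t').
Proof.
elim: w t => [|a w IHw] t /=; first by move=> ->.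
move=> [z tz /IHw zt']; exists (f z) => //.
by rewrite /edge_step -identify_arc; apply: in_imfset.
Qed.

Lemma identify_reaches E U b : reaches E [fset b] U -> reaches (fe @` E) [fset f b] (U `\ v).
Proof.
move=> Eb y; rewrite !inE => /andP[yv /Eb[_ /fset1P -> [w bw]]].
exists (f b); first by rewrite inE.
by exists w; rewrite -(identify_id yv); apply: identify_read.
Qed.

Lemma identify_coset J t : subgroup J -> same_coset J u.1 v.1 -> same_coset J (f t).1 t.1.
Proof.
move=> sJ Juv; rewrite /identify; case: eqP => [->//|_]; exact: same_coset_refl.
Qed.

Lemma identify_over J E : subgroup J -> same_coset J u.1 v.1 -> over J E -> over J (fe @` E).
Proof.
move=> sJ Juv EJ _ /imfsetP[/= e /EJ eJ ->] /=.
apply: (same_coset_trans sJ) (same_coset_sym sJ (identify_coset _ sJ Juv)).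
by apply: (same_coset_trans sJ) eJ; apply/same_cosetM; apply: identify_coset.
Qed.

Variables (E : {fset V * 'I_k * V}) (t : V) (a : 'I_k * bool).
Hypotheses (tu : edge_step E t a u) (tv : edge_step E t a v).

Lemma fold_arcs_eq : fe (arc t a u) = fe (arc t a v).
Proof. by rewrite !identify_arc identifyE (identify_id uv). Qed.

Lemma fold_arcs_neq : arc t a u != arc t a v.
Proof. by apply: contraNneq uv; rewrite /arc; case: (a) => i [] [->]. Qed.

Lemma card_fold : (#|` fe @` E| < #|` E|)%N.
Proof.
have -> : fe @` E = fe @` (E `\ arc t a v).
  apply/fsetP=> e; apply/imfsetP/imfsetP => -[/= e' e'E ->]; last first.
    by exists e' => //; move: e'E; rewrite !inE => /andP[].
  have [->|ne] := eqVneq e' (arc t a v); last by exists e'; rewrite //= !inE ne.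
  exists (arc t a u); last by rewrite fold_arcs_eq.
  by rewrite /= !inE fold_arcs_neq.
rewrite [X in (_ < X)%N](cardfsD1 (arc t a v)) (tv : _ \in E) add1n ltnS.
exact: leq_imfset_card.
Qed.

Lemma card_fold_outside E0 : deterministic eq (edge_step E0) ->
  (#|` (fe @` E) `\` (fe @` E0)| < #|` E `\` E0|)%N.
Proof.
move=> detE0.
have [e [e' [eE e'E e'E0 ee' eqe]]] : exists e e', [/\ e \in E, e' \in E `\` E0,
    e' \notin E0, e != e' & fe e = fe e'].
  have [tu0|tu0] := boolP (arc t a u \in E0); last first.
    exists (arc t a v), (arc t a u).
    by rewrite !inE tu0 eq_sym fold_arcs_neq fold_arcs_eq; split=> //; apply: tu.
  exists (arc t a u), (arc t a v).
  have tv0 : arc t a v \notin E0.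
    by apply/negP=> tv0; move/eqP: uv; apply; apply: detE0 tu0 tv0.
  by rewrite !inE tv0 fold_arcs_neq fold_arcs_eq; split=> //; apply: tv.
rewrite [X in (_ < X)%N](cardfsD1 e') e'E add1n ltnS.
apply: (@leq_trans #|` fe @` ((E `\` E0) `\ e')|); last exact: leq_imfset_card.
apply/fsubset_leq_card/fsubsetP=> d; rewrite in_fsetD => /andP[dE0 /imfsetP[/= d' d'E eqd]].
have d'E0 : d' \notin E0 by apply: contra dE0 => d'E0; rewrite eqd; apply: in_imfset.
have [eqd'|ne] := eqVneq d' e'; last first.
  by apply/imfsetP; exists d'; rewrite // in_fsetD1 ne in_fsetD d'E0.
apply/imfsetP; exists e; last by rewrite eqd eqd' eqe.
rewrite in_fsetD1 ee' in_fsetD eE andbT; apply: contra dE0 => eE0.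
by rewrite eqd eqd' -eqe; apply: in_imfset.
Qed.

End Identify.

(* Fold the graph obtained from the core of L by attaching a petal for each
   generator, until two vertices of the core get identified; up to then every
   fold leaves #|E| - #|U| nonincreasing, and the fold that identifies them
   lowers it, which leaves room for one generator less. *)
Lemma fold_or_embed L J (S : seq (free_group k)) :
  subgroup L -> finite_core L -> J = generated (L `|` [set` S])%classic ->
  core_embeds L J \/
  exists x y (S' : seq (free_group k)),
    [/\ core_vertex L x, core_vertex L y, ~ same_coset L x y,
        (size S' < size S)%N &
        J = generated (generated (L `|` [set x * y^-1]) `|` [set` S'])%classic].
Proof.
move=> sL fL eqJ; have sJ : subgroup J by rewrite eqJ; apply: subgroup_generated.
have LJ : (L `<=` J)%classic by move=> x Lx; rewrite eqJ; apply: sub_generated; left.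
have SJ : ([set` S] `<=` J)%classic by move=> x Sx; rewrite eqJ; apply: sub_generated; right.
have [D [E0 mL]] := finite_core_model sL fL.
have [b bD Lb] := model_base sL mL; have Jb := LJ _ Lb.
have E0D := model_spans mL; have detE0 := model_deterministic sL mL.
have E0J : over J E0 by move=> e /(model_edge_coset mL) h; apply: LJ.
have [E [U [E0E DU [EU EJ] [Eb ES] cardE]]] :=
  attach_petals sJ E0J E0D bD Jb (model_reaches sL mL bD Lb) SJ.
(* Every fold removes a vertex of U, while the core (D, [E0]) stays fixed inside the graph. *)
move cardU: #|` U| => n; elim: n {-2}n (leqnn n) E U cardU E0E DU EU EJ Eb ES cardE.
  move=> n; rewrite leqn0 => /eqP -> E U cardU _ DU.
  by move/fsubset_leq_card: DU; rewrite cardU leqn0 cardfs_eq0 => /eqP D0; rewrite D0 in bD.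
move=> n IHn m mn E U cardU E0E DU EU EJ Eb ES cardE.
have [detE|] := pselect (deterministic eq (edge_step E)); [left|].
  (* No fold is left, so all of J is read at b. Core vertices in the same J-coset are then reached
     by words of equal value and coincide. *)
  have readJ : (J `<=` [set g : free_group k | edge_read E b (val g) b])%classic.
    rewrite eqJ; apply: (generated_sub (subgroup_read (edge_automaton E) detE b)).
    move=> g [/(model_loop sL mL bD Lb)|/ES //]; exact: edge_read_sub.
  move=> x y xV yV xy.
  have readD z : core_vertex L z -> exists d, exists2 w, d \in D &
      edge_read E b w d /\ same_coset L z d.1.
    move=> /(model_vertex mL)[d dD zd].
    have [_ /fset1P -> [w bd]] := model_reaches sL mL bD Lb dD.
    by exists d, w => //; split=> //; apply: edge_read_sub bd.
  have [d [w dD [bd xd]]] := readD x xV; have [d' [w' d'D [bd' yd']]] := readD y yV.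
  suff edd' : d = d' by apply: (same_coset_trans sL) xd _; rewrite edd'; apply: same_coset_sym.
  have bw := edge_read_coset sJ EJ bd; have bw' := edge_read_coset sJ EJ bd'.
  have Jww' : J (eval w * (eval w')^-1).
    apply: (same_coset_absorb sJ Jb).
    rewrite -(same_cosetM _ _ _ (eval w')) mulgA mulgVK.
    apply: (same_coset_trans sJ) bw _; apply: (same_coset_trans sJ) (same_coset_sym sJ bw').
    apply: (same_coset_trans sJ) (LJ _ yd'); apply: (same_coset_trans sJ) xy.
    exact: same_coset_sym (LJ _ xd).
  have bd2 : edge_read E b (val (eval w * (eval w')^-1) ++ w') d'.
    by apply/(read_cat (edge_automaton E)); exists b => //; apply: readJ.
  apply: (read_eval_eq (edge_automaton E) detE bd bd2).
  by rewrite eval_cat eval_val mulgVK.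
move=> /existsNP[t /existsNP[a /existsNP[u /existsNP[v]]]].
move=> /not_implyP[tu /not_implyP[tv /eqP uv]].
(* The vertex v is the one erased. With this choice a fold that does not merge two core vertices
   erases a vertex outside D and fixes D pointwise. *)
wlog vDuD : u v tu tv uv / v \in D -> u \in D.
  move=> wl; have [uD|uD] := boolP (u \in D); first exact: wl tu tv uv _.
  by apply: wl tv tu _ _; rewrite 1?eq_sym // (negPf uD).
have [uU vU] : u \in U /\ v \in U.
  have [tU1 tU2] := EU _ tu; have [_ uU] := arc_ends tU1 tU2.
  have [tU3 tU4] := EU _ tv; have [_ vU] := arc_ends tU3 tU4.
  by [].
have Juv : same_coset J u.1 v.1.
  have step z : edge_step E t a z -> same_coset J (t.1 * letter a) z.1.
    move=> tz; have := @edge_read_coset _ _ J E fst t [:: a] z sJ EJ; rewrite /= mulg1; apply.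
    by exists z.
  exact: (same_coset_trans sJ) (same_coset_sym sJ (step u tu)) (step v tv).
pose f := identify u v; pose fe := identify_edge u v.
have cardU' : (#|` U| = #|` U `\ v|.+1)%N by rewrite (cardfsD1 v) vU.
have foldE' := card_fold uv tu tv.
have [vD|vD] := boolP (v \in D); last first.
  have fD d : d \in D -> f d = d.
    by move=> dD; apply: identify_id; apply: contraNneq vD => <-.
  have fb : f b = b by exact: fD.
  apply: (IHn (#|` U `\ v|) _ (fe @` E) (U `\ v)) => //.
  - by rewrite -ltnS -cardU' cardU.
  - apply/fsubsetP=> e eE0; apply/imfsetP; exists e; first exact: (fsubsetP E0E).
    by have [eD1 eD2] := E0D _ eE0; case: e {eE0} eD1 eD2 => [[x i] y] /= /fD fx /fD fy;
       rewrite /fe /identify_edge /= -/f fx fy.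
  - apply/fsubsetP=> d dD; rewrite !inE (fsubsetP DU) // andbT.
    by apply: contraNneq vD => <-.
  - exact: identify_spans.
  - exact: identify_over.
  - by rewrite -fb; apply: identify_reaches.
  - by move=> s /ES /(identify_read u v); rewrite -/f fb.
  - by move: cardE cardU' foldE'; rewrite -/fe; clear; lia.
right; have uD := vDuD vD.
have cardD' : (#|` D| = #|` D `\ v|.+1)%N by rewrite (cardfsD1 v) vD.
pose N := generated (L `|` [set u.1 * v.1^-1])%classic.
have sN : subgroup N by exact: subgroup_generated.
have LN : (L `<=` N)%classic by move=> x Lx; apply: sub_generated; left.
have Nuv : same_coset N u.1 v.1 by apply: sub_generated; right.
have NJ : (N `<=` J)%classic.
  by apply: (generated_sub sJ) => x [/LJ //|->]; apply: Juv.
have E0N : over N E0 by move=> e /(model_edge_coset mL) h; apply: LN.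
have fbD : f b \in D `\ v by exact: identify_in.
have reachD : reaches (fe @` E) (D `\ v) (U `\ v).
  by move=> y /(identify_reaches u Eb)[_ /fset1P -> ry]; exists (f b).
have DU' : D `\ v `<=` U `\ v.
  by apply/fsubsetP=> d; rewrite !inE => /andP[-> /(fsubsetP DU)].
(* The forest is rooted at the core after the merge, whose arcs lie over N; what hangs outside it
   yields the new generators. *)
have [S' [p' [S'J cardS' p'D p'E]]] := graph_generators (p := fst) (h := fst)
  DU' (identify_spans uv uU EU) (identify_spans uv uD E0D) reachD
  sN sJ NJ (identify_over sJ Juv EJ) (fun d _ => same_coset_refl sJ _)
  (identify_over sN Nuv E0N).
exists u.1, v.1, S'; split.
- exact: (model_core mL).
- exact: (model_core mL).
- by move=> /(model_inj mL uD vD)/eqP; apply/negP.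
(* The merge erases no vertex outside D but loses an arc outside [E0]: this is the strict
   decrease. *)
- have := card_fold_outside uv tu tv detE0.
  have := fsubset_leq_card DU; have := fsubset_leq_card E0E.
  move: cardS' cardE cardD' cardU' (cardfsDS DU') (cardfsDS E0E).
  by clear; lia.
rewrite -/N; apply/seteqP; split; last first.
  by apply: (generated_sub sJ) => x [/NJ|/S'J].
set N' := generated _; have sN' : subgroup N' by exact: subgroup_generated.
have NN' : (N `<=` N')%classic by move=> x Nx; apply: sub_generated; left.
have Nfb : N (f b).1.
  apply/(same_coset1 N); apply: (same_coset_trans sN) (identify_coset b sN Nuv) _.
  by apply/(same_coset1 N); apply: LN.
have readN' g : edge_read E b (val g) b -> N' g.
  move=> /(identify_read u v)/p'E; rewrite -/f eval_val p'D //.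
  by apply: same_coset_absorb; last exact: NN'.
rewrite eqJ; apply: (generated_sub sN') => g [Lg|/ES]; last exact: readN'.
by apply: NN'; apply: LN.
Qed.

End Folding.

(** * Schreier graphs and core graphs *)

Lemma walk_prefix k (G : graph k) (v w : vertex G) p s q :
  walk v (p ++ s :: q) w -> walk v p (step_source s).
Proof.
elim: p v => [|t p IHp] v /=; first by rewrite eq_sym => /andP[].
by case/andP=> -> /IHp.
Qed.

Section SchreierGraph.
Local Open Scope group_scope.
Local Open Scope classical_set_scope.
Variables (k : nat) (L : set (free_group k)).
Hypothesis sL : subgroup L.
Local Notation coset := (vertex (schreier_graph L)).
Local Notation edge := (edge (schreier_graph L)).
Implicit Types (A B : coset) (e : edge) (x y : free_group k).
Implicit Types (p : seq (edge * bool)) (w : seq ('I_k * bool)).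

Lemma translateE x y : translate L x = translate L y <-> same_coset L x y.
Proof.
split=> [eq_xy|xy].
  have : translate L x x by exists 1; [exact: subgroup1|rewrite /= mul1g].
  by rewrite eq_xy => -[h Lh <-]; rewrite /same_coset mulgK.
apply/seteqP; split=> _ [h Lh <-].
  exists (h * (x * y^-1)); first exact: subgroupM.
  by rewrite /= -mulgA mulgVK.
exists (h * (y * x^-1)); last by rewrite /= -mulgA mulgVK.
by apply: subgroupM => //; apply: same_coset_sym.
Qed.

Lemma coset_rep_subproof A : exists x, translate L x = val A.
Proof. by case: A => A /= /set_mem[x _ <-]; exists x. Qed.

Definition coset_rep A : free_group k := sval (cid (coset_rep_subproof A)).

Lemma coset_repE A : translate L (coset_rep A) = val A.
Proof. exact: svalP (cid (coset_rep_subproof A)). Qed.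

Lemma coset_rep_inj A B : same_coset L (coset_rep A) (coset_rep B) -> A = B.
Proof. by move/translateE; rewrite !coset_repE; apply: val_inj. Qed.

Lemma coset_of_subproof x : translate L x \in right_cosets L.
Proof. by apply/mem_set; exists x. Qed.

Definition coset_of x : coset := SigSub (coset_of_subproof x).

Lemma coset_ofK x : same_coset L (coset_rep (coset_of x)) x.
Proof. by apply/translateE; rewrite coset_repE. Qed.

Lemma coset_of_eq x A : same_coset L x (coset_rep A) -> coset_of x = A.
Proof.
by move=> h; apply: coset_rep_inj; apply: (same_coset_trans sL) (coset_ofK x) h.
Qed.

Lemma coset_rep_base : L (coset_rep (basepoint (schreier_graph L))).
Proof.
apply/(same_coset1 L)/translateE; rewrite coset_repE /=; apply/seteqP.
by split=> [x Lx|_ [x Lx <-]]; [exists x; rewrite ?mulg1|rewrite /= mulg1].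
Qed.

Lemma coset_rep_terminus e :
  same_coset L (coset_rep (origin e) * basis_elt (label e)) (coset_rep (terminus e)).
Proof.
apply/translateE; rewrite coset_repE /= -coset_repE /translate image_comp.
by apply: eq_imagel => h _; rewrite /= mulgA.
Qed.

Lemma schreier_edge_eq (d e : edge) : label d = label e -> origin d = origin e -> d = e.
Proof. by case: d e => [A i] [B j] /= -> ->. Qed.

Definition path_word p : seq ('I_k * bool) := [seq (label s.1, s.2) | s <- p].

Lemma step_rep (s : edge * bool) :
  same_coset L (coset_rep (step_source s) * letter (label s.1, s.2))
    (coset_rep (step_target s)).
Proof.
have h := coset_rep_terminus s.1; case: s h => e [] /=; first by rewrite letter_basis.
rewrite (letter_opposite (label e, true)) letter_basis => h.
apply: same_coset_sym => //; rewrite -(same_cosetM _ _ _ (basis_elt (label e))).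
by rewrite mulgVK.
Qed.

Lemma walk_rep A p B : walk A p B ->
  same_coset L (coset_rep A * eval (path_word p)) (coset_rep B).
Proof.
elim: p A => [|s p IHp] A /=; first by move/eqP->; rewrite mulg1; apply: same_coset_refl.
move=> /andP[/eqP <- /IHp]; apply: same_coset_trans => //.
by rewrite mulgA same_cosetM; apply: step_rep.
Qed.

(** In a Schreier graph an edge is determined by its label and either end, so consecutive steps with
    opposite letters traverse the same edge back and forth. *)
Lemma reduced_path_word A p B : walk A p B -> reduced (path_word p) = reduced p.
Proof.
case: p => [//|s p] /= /andP[_]; elim: p s => [//|t p IHp] s /=.
move=> /andP[/eqP st /IHp ->]; congr (~~ _ && _).
apply/eqP/eqP => [est|-> //].
case: s t st est => [d c] [e c'] /= st [eqde eqc]; rewrite eqc /opposite /= in st *.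
congr (_, _); case: c st {eqc} => st; last exact: schreier_edge_eq.
apply: schreier_edge_eq => //; apply: coset_rep_inj.
rewrite -(same_cosetM _ _ _ (basis_elt (label e))).
apply: (same_coset_trans sL) (coset_rep_terminus e) _.
rewrite [terminus e](st : _ = terminus d) [label e](eqde : _ = label d).
by apply: (same_coset_sym sL); apply: coset_rep_terminus.
Qed.

(** An edge is named by its origin, so a negative letter at x uses the edge that starts at the coset
    of x * a, backwards. *)
Definition lift_step x (a : 'I_k * bool) : edge * bool :=
  ((coset_of (if a.2 then x else x * letter a), a.1), a.2).

Lemma lift_step_source x a : step_source (lift_step x a) = coset_of x.
Proof.
case: a => i [] //; apply/esym/coset_of_eq.
apply: (same_coset_trans sL) (coset_rep_terminus (coset_of (x * letter (i, false)), i)).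
rewrite -{1}[x](mulgVK (basis_elt i)); apply/same_cosetM; apply: (same_coset_sym sL).
by rewrite -letter_basis -letter_opposite; apply: coset_ofK.
Qed.

Lemma lift_step_target x a : step_target (lift_step x a) = coset_of (x * letter a).
Proof.
case: a => i [] //; apply/esym/coset_of_eq.
apply: (same_coset_trans sL) (coset_rep_terminus (coset_of x, i)).
by rewrite letter_basis; apply/same_cosetM; apply: (same_coset_sym sL); apply: coset_ofK.
Qed.

Fixpoint lift_path x w : seq (edge * bool) :=
  if w is a :: w' then lift_step x a :: lift_path (x * letter a) w' else [::].

Lemma lift_path_word x w : path_word (lift_path x w) = w.
Proof. by elim: w x => [//|[i c] w IHw] x /=; rewrite IHw. Qed.

Lemma lift_path_walk x w : walk (coset_of x) (lift_path x w) (coset_of (x * eval w)).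
Proof.
elim: w x => [|a w IHw] x /=; first by rewrite mulg1.
by rewrite lift_step_source lift_step_target eqxx mulgA; apply: IHw.
Qed.

Lemma lift_path_cat x u w : lift_path x (u ++ w) = lift_path x u ++ lift_path (x * eval u) w.
Proof. by elim: u x => [|a u IHu] x /=; rewrite ?mulg1 // IHu -mulgA. Qed.

(** Spelling a reduced loop gives a reduced word in L, and lifting such a word gives a reduced loop.
    A loop may cross e backwards, in which case [core_edge_opposite] turns it round. *)
Lemma traversed_edgesE e :
  traversed_edges e <-> core_edge L (coset_rep (origin e)) (label e, true).
Proof.
set base := basepoint (schreier_graph L).
split=> [[p /andP[redp wp] /mapP[[e' c] ecp /= eqe]]|[q [r [red Lw xq]]]].
  rewrite -{e'}eqe in ecp; case/path.splitPr: ecp redp wp => p1 p2 redp wp.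
  have Lp : L (eval (path_word (p1 ++ (e, c) :: p2))).
    apply: (same_coset_absorb sL coset_rep_base).
    exact: walk_rep wp.
  have redw : reduced (path_word (p1 ++ (e, c) :: p2)) by rewrite (reduced_path_word wp).
  have src : core_edge L (coset_rep (step_source (e, c))) (label e, c).
    exists (path_word p1), (path_word p2); rewrite -[_ :: path_word p2]/(path_word ((e, c) :: p2)).
    rewrite -map_cat; split=> //.
    have wp1 := walk_prefix wp.
    apply: same_coset_sym => //; apply: (same_coset_trans sL) (walk_rep wp1).
    rewrite -[X in same_coset _ X _]mul1g; apply/same_cosetM.
    by apply/(same_coset1l sL); apply: coset_rep_base.
  case: c src {redp wp Lp redw} => [//|src].
  apply: core_edge_compat (core_edge_opposite sL src) => //.
  exact: step_rep (e, false).
have base1 : coset_of 1 = base by apply: coset_of_eq; apply/(same_coset1l sL); apply: coset_rep_base.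
exists (lift_path 1 (q ++ (label e, true) :: r)).
  have w1 := lift_path_walk 1 (q ++ (label e, true) :: r).
  apply/andP; split; first by rewrite -(reduced_path_word w1) lift_path_word.
  move: w1; rewrite base1 mul1g; congr (walk _ _ _).
  by apply: coset_of_eq; apply: same_coset_mem => //; apply: coset_rep_base.
rewrite lift_path_cat map_cat mem_cat; apply/orP; right => /=.
rewrite inE; apply/orP; left; apply/eqP; apply: schreier_edge_eq => //=.
apply/esym/coset_of_eq; rewrite mul1g; exact: same_coset_sym.
Qed.

Lemma traversed_verticesE A : traversed_vertices A <-> core_vertex L (coset_rep A).
Proof.
split.
  case=> p lp; rewrite inE => /predU1P[->|/mapP[[e c] ep ->]].
    by left; apply/(same_coset1 L); apply: coset_rep_base.
  have /traversed_edgesE eE : traversed_edges e by exists p => //; apply/mapP; exists (e, c).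
  case: c {ep} => /=; last by right; exists (label e, true).
  apply: core_vertex_compat (coset_rep_terminus e) _ => //.
  by rewrite -letter_basis; apply: core_vertex_end.
case=> [A1|[[i c] Ai]].
  have -> : A = basepoint (schreier_graph L).
    apply: coset_rep_inj; apply: (same_coset_trans sL) A1 _.
    by apply/(same_coset1l sL); apply: coset_rep_base.
  by case: (traversed_basepoint (schreier_graph L)) => /set_mem.
case: c Ai => Ai.
  have /traversed_ends[] : traversed_edges ((A, i) : edge) by apply/traversed_edgesE.
  by [].
set x := coset_rep A * letter (i, false).
have xi : core_edge L (coset_rep (coset_of x)) (i, true).
  apply: core_edge_compat (core_edge_opposite sL Ai) => //.
  by apply: (same_coset_sym sL); apply: coset_ofK.
have /traversed_ends[_] : traversed_edges ((coset_of x, i) : edge) by apply/traversed_edgesE.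
suff -> : terminus ((coset_of x, i) : edge) = A by [].
apply: coset_rep_inj; apply: (same_coset_trans sL) (same_coset_sym sL (coset_rep_terminus _)) _.
rewrite -[X in same_coset _ _ X](mulgVK (basis_elt i)) /=; apply/same_cosetM.
by rewrite -letter_basis -letter_opposite; apply: coset_ofK.
Qed.

End SchreierGraph.

(** * Core graphs and their morphisms through coset representatives *)

Section CoreGraphs.
Local Open Scope group_scope.
Local Open Scope classical_set_scope.
Variable k : nat.
Implicit Types (L M N J : set (free_group k)) (x y : free_group k).

Definition vertex_rep L (v : vertex (core_graph L)) : free_group k :=
  coset_rep (val v).

Section Interface.
Variable L : set (free_group k).
Hypothesis sL : subgroup L.
Implicit Types (u v : vertex (core_graph L)) (d e : edge (core_graph L)).

Lemma vertex_rep_core v : core_vertex L (vertex_rep v).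
Proof. by apply/(traversed_verticesE sL); case: v => v /= /set_mem. Qed.

Lemma vertex_rep_inj u v : same_coset L (vertex_rep u) (vertex_rep v) -> u = v.
Proof. by move=> /(coset_rep_inj sL)/val_inj. Qed.

Lemma core_vertex_rep x : core_vertex L x ->
  exists v, same_coset L x (vertex_rep v).
Proof.
move=> xV; have vV : coset_of L x \in @traversed_vertices k (schreier_graph L).
  apply/mem_set/(traversed_verticesE sL); apply: core_vertex_compat xV => //.
  by apply: (same_coset_sym sL); apply: coset_ofK.
exists (SigSub vV); apply: (same_coset_sym sL); exact: coset_ofK.
Qed.

Lemma vertex_rep_base : L (vertex_rep (basepoint (core_graph L))).
Proof. exact: coset_rep_base. Qed.

Lemma core_edgeP e : core_edge L (vertex_rep (origin e)) (label e, true).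
Proof. by apply/(traversed_edgesE sL (val e)); case: e => e /= /set_mem. Qed.

Lemma edge_eq d e : label d = label e -> origin d = origin e -> d = e.
Proof.
move=> eql eqo; apply: val_inj; apply: schreier_edge_eq => //.
exact: (congr1 val eqo).
Qed.

Lemma core_edge_edge x i : core_edge L x (i, true) ->
  exists e : edge (core_graph L), label e = i /\ same_coset L x (vertex_rep (origin e)).
Proof.
move=> xi; have xx := coset_ofK sL x.
have eE : ((coset_of L x, i) : edge (schreier_graph L)) \in
    @traversed_edges k (schreier_graph L).
  apply/mem_set/(traversed_edgesE sL); apply: core_edge_compat xi => //.
  exact: same_coset_sym.
by exists (SigSub eE); split=> //; apply: same_coset_sym.
Qed.

Lemma vertex_rep_terminus e :
  same_coset L (vertex_rep (origin e) * basis_elt (label e)) (vertex_rep (terminus e)).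
Proof. exact: coset_rep_terminus (val e). Qed.

Lemma core_edge_step x a : core_edge L x a -> exists e, [/\ label e = a.1,
  same_coset L x (vertex_rep (step_source (e, a.2))) &
  same_coset L (x * letter a) (vertex_rep (step_target (e, a.2)))].
Proof.
case: a => i [] xi /=.
  have [e [li xe]] := core_edge_edge xi; exists e; split=> //.
  apply: (same_coset_trans sL) (vertex_rep_terminus e).
  by rewrite letter_basis li; apply/same_cosetM.
have [e [li xe]] := core_edge_edge (core_edge_opposite sL xi); exists e; split=> //.
apply: (same_coset_trans sL) (vertex_rep_terminus e).
rewrite li -[X in same_coset _ X _](mulgVK (basis_elt i)); apply/same_cosetM.
by rewrite -letter_basis -letter_opposite.
Qed.

Lemma step_rep_core e c :
  same_coset L (vertex_rep (step_source (e, c)) * letter (label e, c))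
    (vertex_rep (step_target (e, c))).
Proof. by case: c; [exact: (step_rep sL (val e, true))|exact: (step_rep sL (val e, false))]. Qed.

End Interface.

Section Morphism.
Variables L N : set (free_group k).
Hypotheses (sL : subgroup L) (sN : subgroup N).
Variable f : graph_morphism (core_graph L) (core_graph N).

Lemma morph_step e c : step_source (emap f e, c) = vmap f (step_source (e, c)) /\
  step_target (emap f e, c) = vmap f (step_target (e, c)).
Proof. by case: c; split; first [exact: morph_origin|exact: morph_terminus]. Qed.

Lemma morph_read x w y u v : core_read L x w y ->
  same_coset L x (vertex_rep u) -> same_coset L y (vertex_rep v) ->
  same_coset N (vertex_rep (vmap f u) * eval w) (vertex_rep (vmap f v)).
Proof.
elim: w x u => [|a w IHw] x u /=.
  move=> xy xu yv; rewrite mulg1 (_ : u = v); first exact: same_coset_refl.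
  apply: (vertex_rep_inj sL); apply: (same_coset_trans sL) (same_coset_sym sL xu) _.
  exact: (same_coset_trans sL) xy yv.
move=> [z [xa xaz] zy] xu yv; have [e [le xe ze]] := core_edge_step sL xa.
have <- : step_source (e, a.2) = u.
  apply: (vertex_rep_inj sL); exact: (same_coset_trans sL) (same_coset_sym sL xe) xu.
have zt : same_coset L z (vertex_rep (step_target (e, a.2))).
  exact: (same_coset_trans sL) (same_coset_sym sL xaz) ze.
apply: (same_coset_trans sN) (IHw z _ zy zt yv).
rewrite mulgA; apply/same_cosetM.
have := step_rep_core sN (emap f e) a.2; have [-> ->] := morph_step e a.2.
by rewrite morph_label le; case: (a).
Qed.

Lemma morph_sub : L `<=` N.
Proof.
move=> x Lx; have Lb := vertex_rep_base sL.
have h : same_coset L 1 (vertex_rep (basepoint (core_graph L))) by apply/(same_coset1l sL).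
have := morph_read (core_read_val sL Lx) h h.
by rewrite morph_basepoint eval_val; apply: same_coset_absorb => //; apply: vertex_rep_base.
Qed.

(** The core is connected and f follows words from the basepoint, so f can only send the coset L x
    to N x. This is also the uniqueness of the morphism. *)
Lemma morph_rep v : same_coset N (vertex_rep (vmap f v)) (vertex_rep v).
Proof.
have Lb := vertex_rep_base sL.
have h : same_coset L 1 (vertex_rep (basepoint (core_graph L))) by apply/(same_coset1l sL).
have [w rw] := core_vertex_read sL (vertex_rep_core sL v).
have := morph_read rw h (same_coset_refl sL _); rewrite morph_basepoint => hv.
apply: (same_coset_trans sN) (same_coset_sym sN hv) _.
have : same_coset N (1 * eval w) (vertex_rep v).
  by apply: morph_sub; apply: core_read_coset rw.
apply: (same_coset_trans sN); apply/same_cosetM; apply: same_coset_mem => //.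
  exact: (vertex_rep_base sN).
exact: (subgroup1 sN).
Qed.

End Morphism.

Lemma core_morphism L N : subgroup L -> subgroup N -> L `<=` N ->
  exists f : graph_morphism (core_graph L) (core_graph N), True.
Proof.
move=> sL sN LN.
have fV (v : vertex (core_graph L)) :
    exists v', same_coset N (vertex_rep v) (@vertex_rep N v').
  by apply: (core_vertex_rep sN); apply: core_vertex_sub LN (vertex_rep_core sL v).
have fE (e : edge (core_graph L)) : exists e', label e' = label e /\
    same_coset N (vertex_rep (origin e)) (@vertex_rep N (origin e')).
  by apply: (core_edge_edge sN); apply: core_edge_sub LN (core_edgeP sL e).
have [fv fvP] := choice fV; have [fe feP] := choice fE.
have fo e : origin (fe e) = fv (origin e).
  apply: (vertex_rep_inj sN); have [_ h] := feP e.
  exact: (same_coset_trans sN) (same_coset_sym sN h) (fvP _).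
have ft e : terminus (fe e) = fv (terminus e).
  apply: (vertex_rep_inj sN); have [hl h] := feP e.
  apply: (same_coset_trans sN) (fvP (terminus e)).
  apply: (same_coset_trans sN) (same_coset_sym sN (vertex_rep_terminus sN (fe e))) _.
  apply: (same_coset_trans sN) (LN _ (vertex_rep_terminus sL e)).
  by rewrite hl; apply/same_cosetM; apply: same_coset_sym.
have fl e : label (fe e) = label e by have [] := feP e.
have fb : fv (basepoint (core_graph L)) = basepoint (core_graph N).
  apply: (vertex_rep_inj sN); apply: (same_coset_trans sN) (same_coset_sym sN (fvP _)) _.
  by apply: same_coset_mem => //; [apply: LN|]; exact: vertex_rep_base.
by exists (GraphMorphism fo ft fl fb).
Qed.

(* Composing the isomorphism with the inclusion of the image of eta gives an
   injective morphism from the core of M to that of J. *)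
Lemma image_core H J M (eta : graph_morphism (core_graph H) (core_graph J)) :
  subgroup H -> subgroup J -> subgroup M -> H `<=` M -> M `<=` J ->
  isomorphic (core_graph M) (image_graph eta) ->
  core_embeds M J /\
  forall x i, core_edge M x (i, true) ->
    exists y, core_edge H y (i, true) /\ same_coset M y x.
Proof.
move=> sH sJ sM HM MJ [f [[gv gvK _] [ge geK _]]].
have to e : origin (val (emap f e)) = val (vmap f (origin e)).
  by rewrite -(morph_origin f).
have tt e : terminus (val (emap f e)) = val (vmap f (terminus e)).
  by rewrite -(morph_terminus f).
have tl e : label (val (emap f e)) = label e by rewrite -(morph_label f).
have tb : val (vmap f (basepoint (core_graph M))) = basepoint (core_graph J).
  by rewrite (morph_basepoint f).
pose t : graph_morphism (core_graph M) (core_graph J) :=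
  @GraphMorphism _ _ _ (fun v => val (vmap f v)) (fun e => val (emap f e)) to tt tl tb.
have t_inj u v : vmap t u = vmap t v -> u = v by move=> /val_inj; apply: can_inj gvK _ _.
have emb : core_embeds M J.
  move=> x y xV yV xy.
  have [u xu] := core_vertex_rep sM xV; have [v yv] := core_vertex_rep sM yV.
  suff uv : u = v.
    by apply: (same_coset_trans sM) xu _; rewrite uv; apply: same_coset_sym.
  apply: t_inj; apply: (vertex_rep_inj sJ).
  apply: (same_coset_trans sJ) (morph_rep sM sJ t u) _.
  apply: (same_coset_trans sJ) (same_coset_sym sJ (morph_rep sM sJ t v)).
  apply: (same_coset_trans sJ) (MJ _ yv); apply: (same_coset_trans sJ) xy.
  exact: same_coset_sym (MJ _ xu).
split=> // x i /(core_edge_edge sM)[e [<- xe]].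
have [d _ eqd] : range (emap eta) (emap t e).
  by rewrite /t /=; case: (emap f e) => e' /= /set_mem.
exists (vertex_rep (origin d)).
have eqo : vmap eta (origin d) = vmap t (origin e).
  by rewrite -(morph_origin eta) -(morph_origin t) eqd.
have lde : label d = label e by rewrite -(morph_label eta) -(morph_label t) eqd.
split; first by rewrite -lde; apply: core_edgeP.
apply: (same_coset_trans sM) (same_coset_sym sM xe); apply: emb.
- by apply: core_vertex_sub HM (vertex_rep_core sH _).
- exact: vertex_rep_core.
apply: (same_coset_trans sJ) (morph_rep sM sJ t (origin e)); rewrite -eqo.
exact: same_coset_sym (morph_rep sH sJ eta _).
Qed.

End CoreGraphs.

(** * Immediate quotients *)

Section ImmediateQuotients.
Local Open Scope group_scope.
Local Open Scope classical_set_scope.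
Variable k : nat.
Local Notation merge := Defs.merge.

Lemma merge_sub T (R Q : T -> T -> Prop) (x y : T) :
  (forall z, Q z z) -> (forall z t, Q z t -> Q t z) ->
  (forall t z s, Q z t -> Q t s -> Q z s) ->
  (forall z t, R z t -> Q z t) -> Q x y -> forall z t, merge R x y z t -> Q z t.
Proof.
move=> Qr Qs Qt RQ Qxy z t; elim=> {z t} [z t [/RQ //|[-> ->] //]|//|z t _ /Qs //|].
by move=> z t s _ zt _ ts; apply: Qt zt ts.
Qed.

(** * The folding process *)

Section Folding.
Variables (G : graph k) (u v : vertex G).
Implicit Types (x y z : vertex G) (d e : edge G).

Lemma folding_refl RV RE x : folding u v RV RE -> RV x x.
Proof. by case=> *; apply: rst_refl. Qed.

Lemma folding_sym RV RE x y : folding u v RV RE -> RV x y -> RV y x.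
Proof. by case=> *; apply: rst_sym. Qed.

Lemma folding_trans RV RE y x z : folding u v RV RE -> RV x y -> RV y z -> RV x z.
Proof. by case=> *; apply: rst_trans; eassumption. Qed.

Lemma folding_identified RV RE : folding u v RV RE -> RV u v.
Proof.
elim=> [|{}RV {}RE d e _ uv _ _ _|{}RV {}RE d e _ uv _ _ _].
- by apply: rst_step; right.
- by apply: rst_step; left.
- by apply: rst_step; left.
Qed.

Lemma merge_edges (RV : vertex G -> vertex G -> Prop) RE x y d e :
  (forall d' e', RE d' e' ->
    [/\ label d' = label e', RV (origin d') (origin e') & RV (terminus d') (terminus e')]) ->
  label d = label e -> merge RV x y (origin d) (origin e) ->
  merge RV x y (terminus d) (terminus e) ->
  forall d' e', merge RE d e d' e' ->
    [/\ label d' = label e', merge RV x y (origin d') (origin e') &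
        merge RV x y (terminus d') (terminus e')].
Proof.
move=> RE_RV lde ode tde; apply: merge_sub => //.
- by move=> d'; split=> //; apply: rst_refl.
- by move=> d' e' [-> ? ?]; split=> //; apply: rst_sym.
- by move=> d1 d2 d3 [-> o1 t1] [-> o2 t2]; split=> //; apply: rst_trans; eassumption.
- by move=> d' e' /RE_RV[-> ? ?]; split=> //; apply: rst_step; left.
Qed.

Lemma folding_edges RV RE : folding u v RV RE -> forall d e, RE d e ->
  [/\ label d = label e, RV (origin d) (origin e) & RV (terminus d) (terminus e)].
Proof.
elim=> [d e ->|{}RV {}RE d e _ IH _ lde ode|{}RV {}RE d e _ IH _ lde ode].
- by split=> //; apply: rst_refl.
- by apply: merge_edges => //; apply: rst_step; [left|right].
- by apply: merge_edges => //; apply: rst_step; [right|left].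
Qed.

(** Folding performs forced identifications only: every stage is contained in each equivalence that
    relates u to v and is itself closed under folding. *)
Lemma folding_sub (Q : vertex G -> vertex G -> Prop) RV RE :
  (forall z, Q z z) -> (forall z t, Q z t -> Q t z) ->
  (forall t z s, Q z t -> Q t s -> Q z s) -> Q u v ->
  (forall d e, label d = label e ->
     Q (origin d) (origin e) <-> Q (terminus d) (terminus e)) ->
  folding u v RV RE -> forall x y, RV x y -> Q x y.
Proof.
move=> Qr Qs Qt Quv Qde.
elim=> [|{}RV {}RE d e _ IH _ lde /IH ode|{}RV {}RE d e _ IH _ lde /IH ode].
- by apply: merge_sub => // ? ? ->.
- by apply: merge_sub => //; apply/(Qde d e lde).
- by apply: merge_sub => //; apply/(Qde d e lde).
Qed.

Lemma count_lt (T : eqType) (a1 a2 : pred T) (s : seq T) (x : T) :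
  subpred a1 a2 -> x \in s -> a2 x -> ~~ a1 x -> count a1 s < count a2 s.
Proof.
move=> a12 + a2x a1x; elim: s => [//|y s IHs]; rewrite inE => /predU1P[<-|/IHs lt] /=.
  by rewrite a2x (negPf a1x) add0n add1n ltnS; apply: sub_count.
by case a1y: (a1 y); rewrite ?(a12 _ a1y) ?ltn_add2l //; apply: leq_trans lt (leq_addl _ _).
Qed.

(** Each fold relates a pair of edges not related before, so the number of unrelated pairs drops
    until no fold is possible. *)
Lemma folding_complete (s : seq (edge G)) : (forall e, e \in s) ->
  exists RV RE, folding u v RV RE /\ folded RV RE.
Proof.
move=> s_all.
pose apart (RE : edge G -> edge G -> Prop) (p : edge G * edge G) := `[< ~ RE p.1 p.2 >].
pose pairs := [seq (d, e) | d <- s, e <- s].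
suff fold n RV RE : folding u v RV RE -> count (apart RE) pairs <= n ->
    exists RV RE, folding u v RV RE /\ folded RV RE.
  exact: fold (folding_start u v) (leqnn _).
elim: n RV RE => [|n IHn] RV RE fRE le_n.
  exists RV, RE; split=> // d e _ _; apply: contrapT => nRE.
  move: le_n; rewrite leqn0 -leqn0 leqNgt -has_count => /hasP; apply.
  by exists (d, e); [apply: allpairs_f|apply/asboolP].
have [|nfold] := pselect (folded RV RE); first by exists RV, RE.
have [d [e [lde ode nde]]] : exists d e, [/\ label d = label e,
    RV (origin d) (origin e) \/ RV (terminus d) (terminus e) & ~ RE d e].
  apply: contrapT => h; apply: nfold => d e lde ode; apply: contrapT => nde.
  by apply: h; exists d, e.
have lt_n : count (apart (merge RE d e)) pairs <= n.
  rewrite -ltnS; apply: leq_trans le_n; apply: (@count_lt _ _ _ _ (d, e)).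
  - move=> p /asboolP h; apply/asboolP => REp; apply: h.
    by apply: rst_step; left.
  - exact: allpairs_f.
  - exact/asboolP.
  - by apply/asboolP => h; apply: h; apply: rst_step; right.
case: ode => ode; first exact: IHn (folding_origin fRE nde lde ode) lt_n.
exact: IHn (folding_terminus fRE nde lde ode) lt_n.
Qed.

End Folding.

Implicit Types (L N : set (free_group k)) (x y : free_group k).

Lemma same_coset_edges L N : subgroup L -> subgroup N -> L `<=` N ->
  forall d e : edge (core_graph L), label d = label e ->
    same_coset N (vertex_rep (origin d)) (vertex_rep (origin e)) <->
    same_coset N (vertex_rep (terminus d)) (vertex_rep (terminus e)).
Proof.
move=> sL sN LN d e lde.
have td := LN _ (vertex_rep_terminus sL d); have te := LN _ (vertex_rep_terminus sL e).
split=> h; last first.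
  rewrite -(same_cosetM N _ _ (basis_elt (label d))) {2}lde.
  apply: (same_coset_trans sN) td _; apply: (same_coset_trans sN) h _.
  exact: same_coset_sym.
apply: (same_coset_trans sN) (same_coset_sym sN td) _.
by apply: (same_coset_trans sN) te; rewrite lde; apply/same_cosetM.
Qed.

Lemma folding_coset L N (u v : vertex (core_graph L)) RV RE :
  subgroup L -> subgroup N -> L `<=` N -> same_coset N (vertex_rep u) (vertex_rep v) ->
  folding u v RV RE -> forall p q, RV p q -> same_coset N (vertex_rep p) (vertex_rep q).
Proof.
move=> sL sN LN Nuv.
apply: (folding_sub (Q := fun p q => same_coset N (vertex_rep p) (vertex_rep q))) => //.
- by move=> p; apply: same_coset_refl.
- by move=> p q; apply: same_coset_sym.
- by move=> p q r; apply: same_coset_trans.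
- exact: same_coset_edges.
Qed.

(** The new generator is the quotient of representatives of u and v. All identifications made by
    folding already hold between cosets of the subgroup N it generates with L. *)
Lemma immediate_quotient_generated L L' : subgroup L -> subgroup L' ->
  immediate_quotient (core_graph L) (core_graph L') ->
  exists g, L' = generated (L `|` [set g]).
Proof.
move=> sL sL' [u [v [RV [RE [uv fold foldedR [f [fv fe RVf REf]]]]]]].
pose g := vertex_rep u * (vertex_rep v)^-1; exists g.
have LL' := morph_sub sL sL' f.
set N := generated _; have sN : subgroup N by exact: subgroup_generated.
have LN : L `<=` N by move=> x Lx; apply: sub_generated; left.
have Nuv : same_coset N (vertex_rep u) (vertex_rep v) by apply: sub_generated; right.
have RN := folding_coset sL sN LN Nuv fold.
apply/seteqP; split; last first.
  apply: (generated_sub sL') => x [/LL' //|->]; rewrite -/(same_coset L' _ _).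
  apply: (same_coset_trans sL') (same_coset_sym sL' (morph_rep sL sL' f u)) _.
  rewrite (iffRL (RVf u v) (folding_identified fold)).
  exact: morph_rep.
move=> x L'x.
(* A walk in the quotient lifts to a broken walk in the core of L. Its jumps join identified
   vertices, which represent the same N-coset. *)
have lift q w z p : core_read L' q w z -> same_coset L' q (vertex_rep (vmap f p)) ->
    exists p', same_coset L' z (vertex_rep (vmap f p')) /\
      same_coset N (vertex_rep p * eval w) (vertex_rep p').
  elim: w q p => [|a w IHw] q p /=.
    move=> qz qp; exists p; rewrite mulg1; split; last exact: same_coset_refl.
    exact: (same_coset_trans sL') (same_coset_sym sL' qz) qp.
  move=> [t [qa qat] tz] qp; have [e' [le' qe' te']] := core_edge_step sL' qa.
  have [e _ eqe] : range (emap f) e' by rewrite fe.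
  rewrite -{e'}eqe in le' qe' te'; have [se te] := morph_step f e a.2.
  rewrite morph_label in le'; rewrite se in qe'; rewrite te in te'.
  have [|p' [zp' pp']] := IHw t (step_target (e, a.2)) tz.
    exact: (same_coset_trans sL') (same_coset_sym sL' qat) te'.
  exists p'; split=> //; apply: (same_coset_trans sN) pp'; rewrite mulgA; apply/same_cosetM.
  have := LN _ (step_rep_core sL e a.2); rewrite le' -surjective_pairing.
  apply: (same_coset_trans sN); apply/same_cosetM; apply: RN; apply/RVf.
  apply: (vertex_rep_inj sL'); exact: (same_coset_trans sL') (same_coset_sym sL' qp) qe'.
have L'base : same_coset L' 1 (vertex_rep (vmap f (basepoint (core_graph L)))).
  rewrite morph_basepoint; apply/(same_coset1l sL'); exact: vertex_rep_base.
have [p' [zp' pp']] := lift _ _ _ _ (core_read_val sL' L'x) L'base.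
have ep' : vmap f p' = vmap f (basepoint (core_graph L)).
  apply: (vertex_rep_inj sL'); exact: (same_coset_trans sL') (same_coset_sym sL' zp') L'base.
apply: (same_coset_absorb sN (LN _ (vertex_rep_base sL))).
rewrite eval_val in pp'; apply: (same_coset_trans sN) pp' _.
by apply: RN; apply/RVf.
Qed.

Lemma core_edges_finite L : subgroup L -> finite_core L ->
  exists s : seq (edge (core_graph L)), forall e, e \in s.
Proof.
move=> sL [C coreC].
pose P (ci : free_group k * 'I_k) (e : edge (core_graph L)) :=
  label e = ci.2 /\ same_coset L (vertex_rep (origin e)) ci.1.
pose g ci := if pselect (exists e, P ci e) is left h then Some (sval (cid h)) else None.
exists (pmap g [seq (c, i) | c <- C, i <- enum 'I_k]) => e.
have [c cC ec] := coreC _ (vertex_rep_core sL (origin e)).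
rewrite mem_pmap; apply/mapP; exists (c, label e).
  by apply: allpairs_f; rewrite ?mem_enum.
rewrite /g; case: pselect => [h|[]]; last by exists e.
congr Some; case: (cid h) => e' [/= le' e'c] /=; apply: edge_eq => //.
apply: (vertex_rep_inj sL); exact: (same_coset_trans sL) ec (same_coset_sym sL e'c).
Qed.

(** The completely folded graph reads every element of N at the base, and its vertices are
    identified only within N-cosets. The morphism to the core of N is therefore onto with exactly
    the folding classes as fibres. *)
Lemma immediate_quotient_adjoin L x y : subgroup L -> finite_core L ->
  core_vertex L x -> core_vertex L y -> ~ same_coset L x y ->
  immediate_quotient (core_graph L)
    (core_graph (generated (L `|` [set x * y^-1]))).
Proof.
move=> sL fL xV yV nxy; set N := generated _.
have sN : subgroup N by exact: subgroup_generated.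
have LN : L `<=` N by move=> z Lz; apply: sub_generated; left.
have [u xu] := core_vertex_rep sL xV; have [v yv] := core_vertex_rep sL yV.
have uv : u <> v.
  move=> uv; apply: nxy; apply: (same_coset_trans sL) xu _; rewrite uv; exact: same_coset_sym.
have [s s_all] := core_edges_finite sL fL.
have [RV [RE [fold foldedR]]] := folding_complete u v s_all.
have Nuv : same_coset N (vertex_rep u) (vertex_rep v).
  apply: (same_coset_trans sN) (same_coset_sym sN (LN _ xu)) _.
  by apply: (same_coset_trans sN) (LN _ yv); apply: sub_generated; right.
have RN := folding_coset sL sN LN Nuv fold.
have RErv := folding_edges fold.
(* The folded graph as an automaton on the original vertices; [foldedR] makes it deterministic. *)
pose T p (a : 'I_k * bool) q := exists e, [/\ label e = a.1,
  RV p (step_source (e, a.2)) & RV (step_target (e, a.2)) q].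
have aT : automaton RV T.
  split=> [p|p q|q p r|p p' a q q' pp' qq' [e [le pe qe]]|p a q [e [le pe qe]]].
  - exact: folding_refl fold.
  - exact: folding_sym fold.
  - exact: folding_trans fold.
  - exists e; split=> //; first exact: folding_trans fold (folding_sym fold pp') pe.
    exact: folding_trans fold qe qq'.
  exists e; split=> //=; first by apply: (folding_sym fold); case: (a.2) qe.
  by apply: (folding_sym fold); case: (a.2) pe.
have dT : deterministic RV T.
  move=> p a q r [d [ld pd qd]] [e [le pe qe]].
  have sde := folding_trans fold (folding_sym fold pd) pe.
  have /RErv[_ o t] : RE d e.
    by apply: foldedR; [rewrite ld le|case: (a.2) sde; [left|right]].
  apply: (folding_trans fold) (folding_sym fold qd) _; apply: (folding_trans fold) qe.
  by case: (a.2).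
have coreT p w q x' y' : core_read L x' w y' -> same_coset L x' (vertex_rep p) ->
    same_coset L y' (vertex_rep q) -> read RV T p w q.
  elim: w x' p => [|a w IHw] x' p /=.
    move=> xy' xp yq; rewrite (_ : p = q); first exact: folding_refl fold.
    apply: (vertex_rep_inj sL); apply: (same_coset_trans sL) (same_coset_sym sL xp) _.
    exact: (same_coset_trans sL) xy' yq.
  move=> [z [xa xaz] zy] xp yq; have [e [le xe ze]] := core_edge_step sL xa.
  exists (step_target (e, a.2)).
    exists e; split=> //; last exact: folding_refl fold.
    rewrite (_ : p = step_source (e, a.2)); first exact: folding_refl fold.
    apply: (vertex_rep_inj sL); exact: (same_coset_trans sL) (same_coset_sym sL xp) xe.
  apply: IHw zy _ yq; exact: (same_coset_trans sL) (same_coset_sym sL xaz) ze.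
pose base := basepoint (core_graph L).
have Lbase : L (vertex_rep base) by exact: vertex_rep_base.
have base1 : same_coset L 1 (vertex_rep base) by apply/(same_coset1l sL).
have reach p : exists2 w, read RV T base w p & same_coset L (eval w) (vertex_rep p).
  have [w rw] := core_vertex_read sL (vertex_rep_core sL p).
  exists w; first exact: (coreT _ _ _ _ _ rw base1 (same_coset_refl sL _)).
  by rewrite -[eval w]mul1g; apply: core_read_coset.
have readN n : N n -> read RV T base (val n) base.
  have sK := subgroup_read aT dT base; move: n; apply: (generated_sub sK).
  move=> n [Ln|->]; first exact: (coreT _ _ _ _ _ (core_read_val sL Ln) base1 base1).
  have [wu ru eu] := reach u; have [wv rv ev] := reach v.
  have LK z : L z -> read RV T base (val z) base.
    by move=> Lz; exact: (coreT _ _ _ _ _ (core_read_val sL Lz) base1 base1).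
  have Kuv : read RV T base (val (eval wu * (eval wv)^-1)) base.
    rewrite -eval_inverse -eval_cat; apply: (read_eval aT dT).
    apply/(read_cat aT); exists v; last exact: (read_inverse aT).
    apply: (read_compat aT) ru; first exact: folding_refl fold.
    exact: folding_identified fold.
  have Lx : L (x * (eval wu)^-1).
    exact: (same_coset_trans sL) xu (same_coset_sym sL eu).
  have Ly : L (eval wv * y^-1).
    exact: (same_coset_trans sL) ev (same_coset_sym sL yv).
  (* The middle factor passes through the identified vertices u and v; the outer factors lie in L
     and correct the choice of representatives. *)
  have -> : x * y^-1 =
      x * (eval wu)^-1 * (eval wu * (eval wv)^-1) * (eval wv * y^-1).
    by rewrite !mulgA !mulgVK.
  exact: subgroupM sK (subgroupM sK (LK _ Lx) Kuv) (LK _ Ly).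
have [f _] := core_morphism sL sN LN.
have fRV p q : vmap f p = vmap f q <-> RV p q.
  split=> [fpq|/RN pq]; last first.
    apply: (vertex_rep_inj sN); apply: (same_coset_trans sN) (morph_rep sL sN f p) _.
    apply: (same_coset_trans sN) pq _; exact: same_coset_sym (morph_rep sL sN f q).
  have [wp rp ep] := reach p; have [wq rq eq] := reach q.
  have Npq : N (eval wp * (eval wq)^-1).
    apply: (same_coset_trans sN) (LN _ ep) _.
    apply: (same_coset_trans sN) (same_coset_sym sN (morph_rep sL sN f p)) _.
    rewrite fpq; apply: (same_coset_trans sN) (morph_rep sL sN f q) _.
    exact: same_coset_sym (LN _ eq).
  have rq' : read RV T base (val (eval wp * (eval wq)^-1) ++ wq) q.
    by apply/(read_cat aT); exists base => //; apply: readN.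
  by apply: (read_eval_eq aT dT rp rq'); rewrite eval_cat eval_val mulgVK.
(* The reduced loop of N through the edge is read in the folded graph, which exhibits a preimage. *)
have surj z a : core_edge N z a -> exists e, label e = a.1 /\
    same_coset N z (vertex_rep (vmap f (step_source (e, a.2)))).
  move=> [q [r [red Nw zq]]]; have := readN _ Nw; rewrite val_eval_reduced //.
  move=> /(read_cat aT)[p rp [t [e [le pe _]] _]]; exists e; split=> //.
  apply: (same_coset_trans sN) zq _.
  apply: (same_coset_trans sN) (same_coset_sym sN (morph_rep sL sN f _)).
  apply: (same_coset_trans sN) (RN _ _ pe).
  have TN p' b q' : T p' b q' ->
      same_coset N (vertex_rep p' * letter b) (vertex_rep q').
    move=> [e' [le' xe' /RN ye']]; apply: (same_coset_trans sN) ye'.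
    have := LN _ (step_rep_core sL e' b.2); rewrite le' -surjective_pairing.
    by apply: (same_coset_trans sN); apply/same_cosetM; apply: RN.
  apply: (same_coset_trans sN) (read_same_coset sN RN TN rp).
  rewrite -[X in same_coset _ X _]mul1g; apply/same_cosetM; exact: LN.
exists u, v, RV, RE; split=> //; exists f; split.
- apply/seteqP; split=> // v' _; have [v'1|[a v'a]] := vertex_rep_core sN v'.
    exists base => //; apply: (vertex_rep_inj sN).
    apply: (same_coset_trans sN) (morph_rep sL sN f base) _.
    apply: (same_coset_trans sN) (same_coset_sym sN v'1).
    by apply/(same_coset1 N); apply: LN.
  have [e [_ he]] := surj _ _ v'a; exists (step_source (e, a.2)) => //.
  by apply: (vertex_rep_inj sN); apply: (same_coset_sym sN).
- apply/seteqP; split=> // e' _; have [e [le he]] := surj _ _ (core_edgeP sN e').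
  exists e => //; apply: edge_eq; first by rewrite morph_label.
  by rewrite morph_origin; apply: (vertex_rep_inj sN); apply: (same_coset_sym sN).
- exact: fRV.
move=> d e; split=> [fde|/RErv[lde /fRV ode _]].
  apply: foldedR; first by rewrite -(morph_label f) fde morph_label.
  by left; apply/fRV; rewrite -!(morph_origin f) fde.
by apply: edge_eq; rewrite ?morph_label ?morph_origin.
Qed.

End ImmediateQuotients.

(** * The distance *)

Lemma leastP (P : set nat) n : P n -> P (least P) /\ forall m, P m -> least P <= m.
Proof.
move=> Pn.
have Pex : exists n, `[< P n >] by exists n; apply/asboolP.
have [m /asboolP Pm m_min] := ex_minnP Pex.
apply: (@xgetPex _ 0 [set n | P n /\ forall m, P m -> n <= m]%classic).
by exists m; split=> // m' Pm'; apply: m_min; apply/asboolP.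
Qed.

Section Distance.
Local Open Scope group_scope.
Local Open Scope classical_set_scope.
Variable k : nat.
Implicit Types (H J L M N : set (free_group k)) (S : seq (free_group k)).

Definition quotient_chain H M : set nat :=
  [set m | exists L : nat -> set (free_group k),
    [/\ forall i, i <= m -> subgroup (L i), L 0 = H, L m = M
      & forall i, i < m ->
          immediate_quotient (core_graph (L i)) (core_graph (L i.+1))]].

Lemma quotient_chain_refl H : subgroup H -> quotient_chain H H 0.
Proof. by move=> sH; exists (fun=> H); split. Qed.

Lemma quotient_chain_cons H N M c : subgroup H ->
  immediate_quotient (core_graph H) (core_graph N) ->
  quotient_chain N M c -> quotient_chain H M c.+1.
Proof.
move=> sH HN [L [sL L0 Lc LL]].
exists (fun i => if i is j.+1 then L j else H); split=> //.
  by case=> // i; apply: sL.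
by case=> [_|i]; [rewrite L0|apply: LL].
Qed.

Lemma quotient_chain_generators H M c : quotient_chain H M c ->
  exists2 S, size S = c & M = generated (H `|` [set` S]).
Proof.
move=> [L [sL L0 Lc LL]]; rewrite -{M}Lc.
have : c <= c by []; elim: {1 3 4}c => [_|i IHi lt_i].
  exists [::]; rewrite // L0 (_ : [set` [::]] = set0) ?setU0.
    by rewrite generated_id // -L0; apply: sL.
  by apply/seteqP; split.
have [S sizeS eqL] := IHi (ltnW lt_i).
have [g ->] := immediate_quotient_generated (sL i (ltnW lt_i)) (sL _ lt_i) (LL i lt_i).
exists (g :: S); rewrite /= ?sizeS // eqL generatedUl -setUA; congr (generated (_ `|` _)).
apply/seteqP; split=> x /=; rewrite inE.
  by case=> [->|->]; rewrite ?eqxx ?orbT.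
by case/predU1P=> ?; [right|left].
Qed.

Definition core_onto L M : Prop := forall x i, core_edge M x (i, true) ->
  exists y, core_edge L y (i, true) /\ same_coset M y x.

Lemma core_onto_letter L M : subgroup L -> subgroup M -> core_onto L M ->
  forall x a, core_edge M x a -> exists y, core_edge L y a /\ same_coset M y x.
Proof.
move=> sL sM onto x [i []] xa; first exact: onto.
have [y [yi yx]] := onto _ _ (core_edge_opposite sM xa).
exists (y * letter (i, true)); split; first exact: (core_edge_opposite sL yi).
rewrite -(same_cosetM M _ _ (letter (i, true))) in yx.
by apply: (same_coset_trans sM) yx _; rewrite /= -mulgA oppositeM mulg1; apply: same_coset_refl.
Qed.

(** Edges lift by [core_onto], and the embedding forces each lift to start where the previous one
    ended. A loop of M thus lifts to a walk from the base whose end is equal to it modulo M, hence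
    modulo L. *)
Lemma core_onto_eq L M J : subgroup L -> subgroup M -> L `<=` M -> M `<=` J ->
  core_onto L M -> core_embeds L J -> L = M.
Proof.
move=> sL sM LM MJ onto emb; apply/seteqP; split=> // g Mg.
have lift x q w z : core_read M q w z -> core_vertex L x -> same_coset M x q ->
    exists z', [/\ core_vertex L z', same_coset L (x * eval w) z' & same_coset M z' z].
  elim: w x q => [|a w IHw] x q /=.
    move=> qz xV xq; exists x; rewrite mulg1; split=> //; first exact: same_coset_refl.
    exact: (same_coset_trans sM) xq qz.
  move=> [t [qa qat] tz] xV xq; have [y [ya yq]] := core_onto_letter sL sM onto qa.
  have yx : same_coset L y x.
    apply: emb => //; first by right; exists a.
    by apply: MJ; apply: (same_coset_trans sM) yq _; apply: same_coset_sym.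
  have xa := core_edge_compat sL yx ya.
  have [|z' [z'V xz' z'z]] := IHw _ _ tz (core_vertex_end sL xa).
    by apply: (same_coset_trans sM) qat; apply/same_cosetM.
  by exists z'; split=> //; rewrite mulgA.
have L1 : core_vertex L 1 by left; apply: same_coset_refl.
have [z [zV gz z1]] := lift 1 _ _ _ (core_read_val sM Mg) L1 (same_coset_refl sM 1).
apply/(same_coset1 L); rewrite mul1g eval_val in gz.
apply: (same_coset_trans sL) gz _; apply: emb => //; exact: MJ.
Qed.

Lemma finitely_generated_adjoin L g : finitely_generated L ->
  finitely_generated (generated (L `|` [set g])).
Proof.
move=> [S ->]; exists (g |` S)%fset; rewrite generatedUl; congr generated.
apply/seteqP; split=> x /=; rewrite !inE; first by case=> ->; rewrite ?eqxx ?orbT.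
by case/predU1P=> ?; [right|left].
Qed.

(** Induction on the size of S. If the core of L embeds in that of J then L = M, and the bound is n
    <= #|S| + m. Otherwise one immediate quotient leads to a subgroup that needs fewer
    generators. *)
Lemma quotient_chain_exists L J M S n m :
  subgroup L -> finitely_generated L -> J = generated (L `|` [set` S]) ->
  subgroup M -> L `<=` M -> M `<=` J -> core_embeds M J -> core_onto L M ->
  free_on J n -> free_on M m ->
  exists2 c, quotient_chain L M c & c + n <= size S + m.
Proof.
move=> sL fgL eqJ sM LM MJ embM ontoM Jn Mm.
have sJ : subgroup J by rewrite eqJ; apply: subgroup_generated.
move sizeS: (size S) => s; elim: s {-2}s (leqnn s) L S sizeS sL fgL eqJ LM ontoM.
  move=> s; rewrite leqn0 => /eqP -> L S /size0nil -> sL fgL eqJ LM ontoM.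
  have eqLJ : L = J.
    rewrite eqJ (_ : [set` [::]] = set0) ?setU0 ?generated_id //.
    by apply/seteqP; split.
  have eqLM : L = M by apply/seteqP; split=> //; rewrite eqLJ.
  exists 0; first by rewrite eqLM; apply: quotient_chain_refl.
  by rewrite !add0n (free_on_inj Jn (m := m)) // -eqLJ eqLM.
move=> s IHs s' le_s' L S sizeS sL fgL eqJ LM ontoM.
have [emb|[x [y [S' [xV yV nxy ltS' eqJ']]]]] :=
    fold_or_embed sL (finitely_generated_core fgL) eqJ.
  have eqLM := core_onto_eq sL sM LM MJ ontoM emb.
  exists 0; first by rewrite eqLM; apply: quotient_chain_refl.
  rewrite add0n addnC -sizeS; apply: (free_on_le Jn Mm) => //; first by rewrite -eqLM eqJ.
  by move=> z Sz; rewrite eqJ; apply: sub_generated; right.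
pose N := generated (L `|` [set x * y^-1]).
have sN : subgroup N by exact: subgroup_generated.
have LN : L `<=` N by move=> z Lz; apply: sub_generated; left.
have NJ : N `<=` J by move=> z Nz; rewrite eqJ'; apply: sub_generated; left.
(* The chain cannot overshoot M: x and y agree modulo J, hence modulo M because the core of M
   embeds. *)
have Mxy : same_coset M x y.
  apply: embM; [exact: core_vertex_sub LM xV|exact: core_vertex_sub LM yV|].
  by apply: NJ; apply: sub_generated; right.
have NM : N `<=` M by apply: (generated_sub sM) => z [/LM|->].
have ontoN : core_onto N M.
  move=> z i /ontoM[t [ti tz]]; exists t; split=> //; exact: core_edge_sub LN ti.
have [||c Nc le_c] := IHs (size S') _ N S' erefl sN _ eqJ' NM ontoN.
- by rewrite -ltnS; apply: leq_trans le_s'; rewrite -sizeS.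
- exact: finitely_generated_adjoin.
exists c.+1; last by move: le_c ltS'; rewrite -sizeS; clear; lia.
apply: quotient_chain_cons Nc => //.
exact: immediate_quotient_adjoin (finitely_generated_core fgL) xV yV nxy.
Qed.

End Distance.

Local Open Scope classical_set_scope.
Local Open Scope ring_scope.

Theorem corollary3p6 (k : nat) (H J M : set (free_group k))
  (subgroup_H : subgroup H) (subgroup_J : subgroup J)
  (fg_H : finitely_generated H) (fg_J : finitely_generated J)
  (le_HJ : H `<=` J)
  (eta : graph_morphism (core_graph H) (core_graph J))
  (subgroup_M : subgroup M) (le_HM : H `<=` M) (le_MJ : M `<=` J)
  (core_M : isomorphic (core_graph M) (image_graph eta)) :
  (complementary_rank H J)%:Z =
    (distance H M)%:Z + (rank J)%:Z - (rank M)%:Z.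
Proof.
have [embM ontoM] :=
  image_core subgroup_H subgroup_J subgroup_M le_HM le_MJ core_M.
have [n [m [S [Jn Mm SJ genJ leS]]]] := free_factor_generators subgroup_M
  subgroup_J le_MJ (finitely_generated_core fg_J) embM.
rewrite (rank_free_on Jn) (rank_free_on Mm).
pose gens := [set n | exists T : {fset free_group k},
  #|` T|%fset = n /\ J = generated (H `|` [set` T])].
(* Generators of J complement H, so [least] does not fall back on its default 0. *)
have gens_J : exists n, gens n.
  have [T eqJ] := fg_J; exists #|` T|%fset, T; split=> //.
  apply/seteqP; split; first by rewrite eqJ; apply: generated_mono => x; right.
  apply: generated_sub => // x [/le_HJ //|Tx]; rewrite eqJ; exact: sub_generated.
have [n0 /leastP[[T [cardT eqJ]] t_min]] := gens_J.
rewrite -[complementary_rank H J]/(least gens).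
have [c0 chain0 le_c0] := quotient_chain_exists (S := enum_fset T) subgroup_H fg_H
  eqJ subgroup_M le_HM le_MJ embM ontoM Jn Mm.
have [chain_d d_min] := leastP chain0.
rewrite -[distance H M]/(least (quotient_chain H M)).
have [S' sizeS' eqM] := quotient_chain_generators chain_d.
(* S' leads from H to M along a shortest chain and S from M to J. Repetitions in their union can
   only lower the count, so an upper bound on the minimum results. *)
have genT : gens #|` [fset x in S' ++ S]|%fset.
  exists [fset x in S' ++ S]%fset; split=> //.
  have -> : [set` [fset x in S' ++ S]%fset] = [set` S'] `|` [set` S].
    have memT x : (x \in [fset x in S' ++ S]%fset) = (x \in S') || (x \in S).
      by rewrite in_fset -[LHS]/(x \in S' ++ S) mem_cat.
    by apply/seteqP; split=> x /=; rewrite memT; [move/orP|move=> h; apply/orP].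
  rewrite setUA -generatedUl -eqM; apply/seteqP; split=> //.
  by apply: generated_sub => // x [/le_MJ|/SJ].
have le_t := t_min _ genT; have le_d := d_min _ chain0.
have le_card : (#|` [fset x in S' ++ S]|%fset <= size S' + size S)%N.
  by rewrite card_fseq -size_cat size_undup.
have cardT' : size (enum_fset T) = least gens by rewrite -cardT.
move: le_t le_d le_card le_c0 leS; rewrite cardT' sizeS'; clear; lia.
Qed.
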